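(* Let $1\le p<+\infty$ and let $h:[0,\infty)\to[0,\infty)$ be increasing with $h(0)=0$ and $\lim_{t\to+\infty}h(t)=+\infty$. Assume: (1) there exists a constant $C_0>0$ such that for every $f\in\mathbf{B}^{p,h}(X)$ $$\|f\|_{p,h}\le C_0\liminf_{t\to0^+}\frac1{h(t)}\left(\int_X P_t(|f-f(y)|^p)(y)\,d\mu(y)\right)^{1/p};$$ (2) there exists a non-decreasing function $V:[0,\infty)\to[0,\infty)$ with $\lim_{t\to+\infty}V(t)=+\infty$ such that for every $f\in L^1(X,\mu)$ and every $t>0$ $$\|P_tf\|_{L^\infty(X,\mu)}\le\frac1{V(t)}\|f\|_{L^1(X,\mu)};$$ (3) $\phi$ is a Young function for which there is $B>0$ with $\phi(2s)\le B\phi(s)$ for all $s>0$, and such that for every $s>0$ $$(h\circ V^{-1})(s)^p\le s\,\phi^{-1}(1/s),\qquad\text{where } V^{-1}(t)=\inf\{s:V(s)>t\}.$$ Then there exists a constant $C>0$ such that for every $f\in\mathbf{B}^{p,h}(X)$ $$\big\||f|^p\big\|_\phi^{1/p}\le C\,\|f\|_{p,h}.$$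
   Context: $(X,\mu)$ is a measurable space with a $\sigma$-finite measure $\mu$, whose $\sigma$-algebra is countably generated and for which the measure decomposition (disintegration) theorem holds. $(\mathcal E,\mathcal F)$ is a Dirichlet form on $L^2(X,\mu)$ and $\{P_t\}_{t\ge0}$ is the associated symmetric Markov (heat) semigroup, assumed conservative: $P_t1=1$. It is represented by probability kernels, $P_tf(x)=\int_Xf(y)\,p_t(x,dy)$. Besov classes: for $f\in L^p(X,\mu)$, $\|f\|_{p,h}:=\sup_{t>0}\frac1{h(t)}\left(\int_XP_t(|f-f(y)|^p)(y)\,d\mu(y)\right)^{1/p}$, where $P_t(|f-f(y)|^p)(y)=\int_X|f(x)-f(y)|^p\,p_t(y,dx)$, and $\mathbf{B}^{p,h}(X):=\{f\in L^p(X,\mu):\|f\|_{p,h}<+\infty\}$. Young functions and Orlicz norm: a Young function is a function $\phi:[0,\infty)\to[0,\infty]$ of the form $\phi(x)=\int_0^x\Phi(\tau)\,d\tau$, where $\Phi:[0,\infty)\to[0,\infty]$ is right-continuous, positive, non-decreasing, with $\Phi(0)=0$ and $\lim_{\tau\to\infty}\Phi(\tau)=+\infty$. Its Young conjugate is $\psi(t)=\sup_{s>0}\{st-\phi(s)\}$, and $\|f\|_\phi:=\sup\{\int_X|fg|\,d\mu: g \text{ Borel},\ \int_X\psi(|g|)\,d\mu\le1\}$. *)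

(* Defs.v *)
From HB Require Import structures.
From mathcomp Require Import all_boot all_order all_algebra.
From mathcomp Require Import all_classical all_reals all_analysis.

Set Implicit Arguments.
Unset Strict Implicit.
Unset Printing Implicit Defensive.

Import Order.TTheory GRing.Theory Num.Theory.
Import numFieldNormedType.Exports.

Local Open Scope classical_set_scope.
Local Open Scope ring_scope.

Definition countably_generated d (X : measurableType d) : Prop :=
  exists2 G : set (set X), countable G & @measurable d X = <<s G>>.

(* Every probability measure nu on X * X disintegrates as
   nu(dx, dy) = k(x, dy) nu_1(dx), where nu_1 is the first marginal of nu. *)
Definition measure_decomposition (R : realType) d (X : measurableType d) : Prop :=
  forall nu : probability (X * X)%type R,
  exists k : R.-pker X ~> X, forall A B : set X, measurable A -> measurable B ->
    nu (A `*` B) = (\int[pushforward nu fst]_(x in A) k x B)%E.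

Section L2.
Context {d} {X : measurableType d} {R : realType}.
Variable mu : {measure set X -> \bar R}.

(* Elements of L^2 are represented by square integrable functions X -> R;
   the structures below are required to be compatible with equality mu-almost
   everywhere. *)
Definition L2dot (f g : X -> R) : R := \int[mu]_x (f x * g x).

Definition L2dist (f g : X -> R) : \bar R := 'N[mu]_(2%:E)[EFin \o (f \- g)%R]%E.

Record dirichlet_form (D : set (X -> R)) (E : (X -> R) -> (X -> R) -> R) : Prop := {
  df_L2 : forall f, D f -> f \in Lfun mu 2%:E ;
  df_aeD : forall f g, D f -> g \in Lfun mu 2%:E -> f = g %[ae mu] -> D g ;
  df_aeE : forall f g v, D f -> D g -> D v -> f = g %[ae mu] -> E f v = E g v ;
  df_0 : D (cst 0) ;
  df_lin : forall (a : R) f g, D f -> D g -> D (a \*: f \+ g) ;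
  df_dense : forall f, f \in Lfun mu 2%:E -> forall e : R, 0 < e ->
    exists2 g, D g & (L2dist f g < e%:E)%E ;
  df_bilin : forall (a : R) f g v, D f -> D g -> D v ->
    E (a \*: f \+ g) v = a * E f v + E g v ;
  df_sym : forall f g, D f -> D g -> E f g = E g f ;
  df_ge0 : forall f, D f -> 0 <= E f f ;
  (* closedness: D is complete for the inner product E(f, g) + <f, g> *)
  df_closed : forall u : (X -> R)^nat, (forall n, D (u n)) ->
    (forall e : R, 0 < e -> exists N : nat, forall m n : nat, (N <= m)%N -> (N <= n)%N ->
      E (u m \- u n) (u m \- u n) + L2dot (u m \- u n) (u m \- u n) < e) ->
    exists2 v, D v &
      E (u n \- v) (u n \- v) + L2dot (u n \- v) (u n \- v) @[n --> \oo] --> (0 : R) ;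
  df_markov : forall f, D f ->
    let g := fun x => Num.min (Num.max (f x) 0) 1 in D g /\ E g g <= E f f }.

Record markov_semigroup (P : R -> (X -> R) -> (X -> R)) : Prop := {
  sg_L2 : forall t f, 0 <= t -> f \in Lfun mu 2%:E -> P t f \in Lfun mu 2%:E ;
  sg_ae : forall t f g, 0 <= t -> f \in Lfun mu 2%:E -> g \in Lfun mu 2%:E ->
    f = g %[ae mu] -> P t f = P t g %[ae mu] ;
  sg_lin : forall t (a : R) f g, 0 <= t -> f \in Lfun mu 2%:E -> g \in Lfun mu 2%:E ->
    P t (a \*: f \+ g) = a \*: P t f \+ P t g %[ae mu] ;
  sg_0 : forall f, f \in Lfun mu 2%:E -> P 0 f = f %[ae mu] ;
  sg_D : forall s t f, 0 <= s -> 0 <= t -> f \in Lfun mu 2%:E ->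
    P (s + t) f = P s (P t f) %[ae mu] ;
  sg_contraction : forall t f, 0 <= t -> f \in Lfun mu 2%:E ->
    ('N[mu]_(2%:E)[EFin \o P t f] <= 'N[mu]_(2%:E)[EFin \o f])%E ;
  sg_cont : forall f, f \in Lfun mu 2%:E -> L2dist (P t f) f @[t --> 0^'+] --> 0%E ;
  sg_sym : forall t f g, 0 <= t -> f \in Lfun mu 2%:E -> g \in Lfun mu 2%:E ->
    L2dot (P t f) g = L2dot f (P t g) ;
  sg_markov : forall t f, 0 <= t -> f \in Lfun mu 2%:E ->
    (\forall x \ae mu, 0 <= f x <= 1) -> \forall x \ae mu, 0 <= P t f x <= 1 }.

(* Lf = g, for L the infinitesimal generator of P *)
Definition semigroup_generator (P : R -> (X -> R) -> (X -> R)) (f g : X -> R) : Prop :=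
  [/\ f \in Lfun mu 2%:E, g \in Lfun mu 2%:E &
      L2dist (fun x => t^-1 * (P t f x - f x)) g @[t --> 0^'+] --> 0%E].

(* Lf = g, for L the nonpositive self-adjoint operator of the form (E, D) *)
Definition form_generator (D : set (X -> R)) (E : (X -> R) -> (X -> R) -> R)
    (f g : X -> R) : Prop :=
  [/\ D f, g \in Lfun mu 2%:E & forall v, D v -> E f v = - L2dot g v].

Definition heat_semigroup (D : set (X -> R)) (E : (X -> R) -> (X -> R) -> R)
    (P : R -> (X -> R) -> (X -> R)) : Prop :=
  markov_semigroup P /\
  forall f g, semigroup_generator P f g <-> form_generator D E f g.

(* P_t 1 = 1. The function 1 need not be in L^2, so that P_t 1 is the monotone
   limit of P_t u_n for u_n in L^2 increasing to 1. *)
Definition conservative (P : R -> (X -> R) -> (X -> R)) : Prop :=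
  forall (t : R) (u : (X -> R)^nat), 0 <= t ->
    (forall n, u n \in Lfun mu 2%:E) -> (forall n x, 0 <= u n x) ->
    (forall x, nondecreasing_seq (u ^~ x)) ->
    (forall x, u n x @[n --> \oo] --> (1 : R)) ->
    \forall x \ae mu, P t (u n) x @[n --> \oo] --> (1 : R).

Definition kernel_op (k : R.-pker X ~> X) (f : X -> R) (x : X) : \bar R :=
  (\int[k x]_y (f y)%:E)%E.

Definition represented_by (P : R -> (X -> R) -> (X -> R))
    (k : R -> R.-pker X ~> X) : Prop :=
  forall t f, 0 <= t -> f \in Lfun mu 2%:E ->
    \forall x \ae mu, (P t f x)%:E = kernel_op (k t) f x.

End L2.

Section besov.
Context {d} {X : measurableType d} {R : realType}.
Variables (mu : {measure set X -> \bar R}) (k : R -> R.-pker X ~> X).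
Variables (p : R) (h : R -> R).
Local Open Scope ereal_scope.

(* (1 / h(t)) (int_X P_t(|f - f(y)|^p)(y) dmu(y))^(1/p) *)
Definition besov_quotient (f : X -> R) (t : R) : \bar R :=
  (h t)%:E^-1 *
  (\int[mu]_y kernel_op (k t) (fun x => (`|f x - f y| `^ p)%R) y) `^ p^-1.

Definition besov_norm (f : X -> R) : \bar R :=
  ereal_sup [set besov_quotient f t | t in [set t | (0 < t)%R]].

Definition besov_class : set (X -> R) :=
  [set f | f \in Lfun mu p%:E /\ besov_norm f < +oo].

End besov.

Section orlicz.
Context {R : realType}.

(* Functions on [0, oo[ are represented by functions on R whose values at
   negative numbers are irrelevant. *)
Definition young_function (phi : R -> \bar R) : Prop :=
  exists Phi : R -> \bar R,
  [/\ Phi 0 = 0%E /\ (forall x : R, (0 < x)%R -> (0 < Phi x)%E),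
      (forall x y : R, 0 <= x -> x <= y -> (Phi x <= Phi y)%E),
      (forall x, 0 <= x -> Phi y @[y --> x^'+] --> Phi x),
      Phi x @[x --> +oo] --> +oo%E &
      forall x, 0 <= x -> phi x = (\int[lebesgue_measure]_(t in `[0%R, x]) Phi t)%E].

Definition young_conjugate (phi : R -> \bar R) (t : R) : \bar R :=
  ereal_sup [set ((s * t)%:E - phi s)%E | s in [set s : R | 0 < s]].

Definition orlicz_norm d (X : measurableType d) (mu : {measure set X -> \bar R})
    (phi : R -> \bar R) (f : X -> R) : \bar R :=
  ereal_sup [set (\int[mu]_x `|f x * g x|%R%:E)%E | g in
    [set g : X -> R | measurable_fun setT g /\
                      (\int[mu]_x young_conjugate phi `|g x|%R <= 1)%E]].

(* F^-1(t) = inf {s >= 0 : F(s) > t}, which is the usual inverse of F when F is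
   an increasing bijection of [0, oo[. *)
Definition rc_inverse (F : R -> \bar R) (t : R) : R :=
  inf [set s : R | 0 <= s /\ (t%:E < F s)%E].

End orlicz.

(* Main.v *)
Require Import Defs.
From HB Require Import structures.
From mathcomp Require Import all_boot all_order all_algebra.
From mathcomp Require Import all_classical all_reals all_analysis.
From mathcomp Require Import measurable_realfun ess_sup_inf.
From mathcomp Require Import ring lra.

Set Implicit Arguments.
Unset Strict Implicit.
Unset Printing Implicit Defensive.

Import Order.TTheory GRing.Theory Num.Theory.
Import numFieldNormedType.Exports.

Local Open Scope classical_set_scope.
Local Open Scope ring_scope.

(** The proof combines a capacity-type estimate on superlevel sets with Maz'ya's
    truncation method.

    Fix f in the Besov class and r > 0, and cut |f| at the levels l_n = r 2^n. Write
    f_n for the slice of |f| between l_n and 2 l_n (so 0 <= f_n <= l_n), a_n for the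
    measure of the set |f| > l_n, and F for the inverse of phi.

    Capacity estimate. The L^1 norm of f_n is at most l_n a_n, so at the time
    t = V^-1(2 a_n) ultracontractivity makes the heat flow of f_n at most l_n / 2. As
    f_n = l_n where |f| >= l_{n+1}, the heat kernel at time t sees a deviation of at
    least l_n / 2 in the mean from every such point, whence
      a_{n+1} (l_n / 4)^p <= h(t)^p ||f_n||^p <= 2 a_n F(1 / (2 a_n)) ||f_n||^p
    by the growth condition on h (level_set_estimate, superlevel_capacity). The
    functions V and h may jump, and the value of h is controlled at t only. Therefore
    the bound on the heat flow is first proved at all later times, and then transferred
    to t by the strong continuity of the semigroup in L^2 (ae_semigroup_le_right).

    Summation over the levels. Put b_n = l_n^p / F(1 / (2 a_n)), which is level_term.
    If a_{n+1} is much smaller than a_n, the doubling of phi gives b_{n+1} <= b_n / 2.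
    Otherwise the capacity estimate bounds b_{n+1} by a multiple of ||f_n||^p. In both
    cases b_{n+1} <= b_n / 2 + c ||f_n||^p (level_recursion), so the sum of the b_n is
    at most 2 b_0 plus a multiple of the sum of the ||f_n||^p.

    Energies of the slices. At a fixed time the energies of the slices add up to at
    most the energy of f, because the sum over n of |f_n(x) - f_n(y)|^p is at most
    |f(x) - f(y)|^p. The hypothesis that the Besov norm is controlled by a lower limit
    as t tends to 0 allows one common time for finitely many slices, and the sum of
    the ||f_n||^p is thus at most a multiple of ||f||^p (sum_besov_norm_slice_le).

    Orlicz norm. By Young's inequality the set |f| > l_n has Orlicz norm at most
    3 / F(1 / (2 a_n)) (orlicz_set_bound), so the part of |f|^p between the lowest and
    the highest level has Orlicz norm at most a multiple of the sum of the b_n. As r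
    tends to 0, so does b_0, because a_0 = O(r^-p) and phi(s) = o(s) at the origin
    (level_term_vanish). *)

(** * Monotonicity of the integral *)

(** The integral of a nonnegative function is the supremum over the simple functions
    below it, so it is monotone on arbitrary functions. The derivative Phi of a
    Young function and the integrand psi(|g|) are compared to others in this way. *)
Lemma le_integral_nonmeasurable d (T : measurableType d) (R : realType)
    (mu : {measure set T -> \bar R}) (D1 D2 : set T) (f g : T -> \bar R) :
  (forall x, D1 x -> (0 <= f x)%E) -> (forall x, D2 x -> (0 <= g x)%E) ->
  (forall x, D1 x -> D2 x /\ (f x <= g x)%E) ->
  (\int[mu]_(x in D1) f x <= \int[mu]_(x in D2) g x)%E.
Proof.
move=> f0 g0 fg; rewrite (integral_mkcond D1) (integral_mkcond D2).
have f0' x : (0 <= (f \_ D1) x)%E by apply: erestrict_ge0.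
have g0' x : (0 <= (g \_ D2) x)%E by apply: erestrict_ge0.
rewrite !ge0_integralTE//; apply: ereal_sup_le => _ [s sf <-]; exists s => // x.
apply: (le_trans (sf x)); rewrite /patch; case: ifPn => [xD1|_]; last first.
  by case: ifPn => // /set_mem; exact: g0.
by have [D2x fgx] := fg _ (set_mem xD1); rewrite mem_set.
Qed.

(** * Generalized inverses and Young functions *)

Section right_continuous_inverse.
Context {R : realType}.
Variable G : R -> \bar R.

Let level (t : R) := [set s : R | 0 <= s /\ (t%:E < G s)%E].

Lemma rc_inverse_ge0 (t : R) : 0 <= rc_inverse G t.
Proof.
rewrite /rc_inverse -/(level t).
have [->|S0] := eqVneq (level t) set0; first by rewrite inf0.
by apply: lb_le_inf; [exact/set0P | move=> s []].
Qed.

Lemma le_of_lt_rc_inverse (s t : R) : 0 <= s -> s < rc_inverse G t -> (G s <= t%:E)%E.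
Proof.
move=> s0 st; rewrite leNgt; apply/negP => tG.
have : rc_inverse G t <= s by apply: ge_inf; [exists 0 => ? [] | split].
by rewrite leNgt st.
Qed.

Hypothesis G_ndecr : forall x y : R, 0 <= x -> x <= y -> (G x <= G y)%E.
Hypothesis G_unbounded : forall t : R, exists2 s : R, 0 <= s & (t%:E < G s)%E.

Let has_inf_level t : has_inf (level t).
Proof. by have [s s0 ts] := G_unbounded t; split; [exists s | exists 0 => ? []]. Qed.

Lemma lt_of_rc_inverse_lt (s t : R) : rc_inverse G t < s -> (t%:E < G s)%E.
Proof.
move=> ts; have [u [u0 tu] us] := inf_lt (has_inf_level t).1 ts.
by apply: (lt_le_trans tu); apply: G_ndecr => //; exact: ltW.
Qed.

Lemma le_rc_inverse (s t : R) : (G s <= t%:E)%E -> s <= rc_inverse G t.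
Proof.
move=> Gs; rewrite leNgt; apply/negP => /lt_of_rc_inverse_lt.
by rewrite ltNge Gs.
Qed.

Lemma rc_inverse_ndecr (s t : R) : s <= t -> rc_inverse G s <= rc_inverse G t.
Proof.
move=> st; apply: lb_le_inf; first by have [] := has_inf_level t.
move=> u [u0 tu]; apply: ge_inf; first by have [] := has_inf_level s.
by split=> //; apply: le_lt_trans tu; rewrite lee_fin.
Qed.

End right_continuous_inverse.

Section young_function.
Context {R : realType}.
Variable phi : R -> \bar R.
Hypothesis phi_young : young_function phi.

Lemma young_function_ge0 (x : R) : 0 <= x -> (0 <= phi x)%E.
Proof.
have [Phi [[Phi0 Phi_gt0] _ _ _ phiE]] := phi_young.
move=> x0; rewrite phiE//; apply: integral_ge0 => t /=.
rewrite in_itv/= => /andP[]; rewrite le_eqVlt => /predU1P[<- _|/Phi_gt0/ltW//].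
by rewrite Phi0.
Qed.

Lemma young_function_ndecr (x y : R) : 0 <= x -> x <= y -> (phi x <= phi y)%E.
Proof.
have [Phi [[Phi0 Phi_gt0] _ _ _ phiE]] := phi_young.
have Phi_ge0 (t : R) : 0 <= t -> (0 <= Phi t)%E.
  by rewrite le_eqVlt => /predU1P[<-|/Phi_gt0/ltW//]; rewrite Phi0.
move=> x0 xy; rewrite !phiE ?(le_trans x0)//.
apply: le_integral_nonmeasurable => t /=; rewrite !in_itv/= => /andP[t0 tx].
- exact: Phi_ge0.
- exact: Phi_ge0.
- by rewrite t0 (le_trans tx).
Qed.

(** For y >= x the derivative is at least Phi(x/2) on the upper half of [0, y]. *)
Lemma young_function_linear_lower (x : R) : 0 < x ->
  exists2 c : R, 0 < c & forall y : R, x <= y -> ((c * y)%:E <= phi y)%E.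
Proof.
have [Phi [[Phi0 Phi_gt0] Phi_nd _ _ phiE]] := phi_young => x0.
have Phi_ge0 (t : R) : 0 <= t -> (0 <= Phi t)%E.
  by rewrite le_eqVlt => /predU1P[<-|/Phi_gt0/ltW//]; rewrite Phi0.
have x2 : 0 < x / 2 by rewrite divr_gt0.
have [c c0 cPhi] : exists2 c : R, 0 < c & (c%:E <= Phi (x / 2)%R)%E.
  have := Phi_gt0 _ x2; case: (Phi _) => [r|_|//]; last by exists 1; rewrite ?leey.
  by rewrite lte_fin => r0; exists r.
exists (c / 2); first by rewrite divr_gt0.
move=> y xy; have y0 : 0 < y := lt_le_trans x0 xy.
rewrite phiE ?(ltW y0)//.
have -> : ((c / 2 * y)%:E = \int[lebesgue_measure]_(t in `[(y / 2)%R, y]) (cst c%:E) t)%E.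
  rewrite integral_cst//= lebesgue_measure_itv/= lte_fin ifT; last by lra.
  by rewrite -EFinB -EFinM; congr EFin; field.
apply: le_integral_nonmeasurable => t /=; rewrite !in_itv/= => /andP[t0 tx].
- by rewrite lee_fin ltW.
- exact: Phi_ge0.
- rewrite tx andbT; split; first by lra.
  by apply: (le_trans cPhi); apply: Phi_nd; lra.
Qed.

Lemma young_function_gt0 (x : R) : 0 < x -> (0 < phi x)%E.
Proof.
move=> x0; have [c c0 /(_ _ (lexx x))] := young_function_linear_lower x0.
by apply: lt_le_trans; rewrite lte_fin mulr_gt0.
Qed.

Lemma young_function_unbounded (t : R) : exists2 s : R, 0 <= s & (t%:E < phi s)%E.
Proof.
have [c c0 cphi] := young_function_linear_lower (@ltr01 R).
exists (1 + `|t| / c); first by rewrite addr_ge0// divr_ge0// ltW.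
apply: (@lt_le_trans _ _ (c * (1 + `|t| / c))%:E); last first.
  by apply: cphi; rewrite lerDl divr_ge0// ltW.
rewrite lte_fin mulrDr mulr1 mulrCA divff ?gt_eqF// mulr1.
by apply: (le_lt_trans (ler_norm t)); rewrite ltrDr.
Qed.

(** phi is o(x) at the origin, since its derivative Phi is right-continuous
    there with Phi(0) = 0. *)
Lemma young_function_sublinear (e : R) : 0 < e ->
  exists2 x : R, 0 < x & forall y : R, 0 <= y -> y <= x -> (phi y <= (e * y)%:E)%E.
Proof.
have [Phi [[Phi0 Phi_gt0] Phi_nd Phi_rc _ phiE]] := phi_young => e0.
have Phi_ge0 (t : R) : 0 <= t -> (0 <= Phi t)%E.
  by rewrite le_eqVlt => /predU1P[<-|/Phi_gt0/ltW//]; rewrite Phi0.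
have [x x0 Phix] : exists2 x : R, 0 < x & (Phi x <= e%:E)%E.
  have Phi_near : \forall x \near (0:R)^'+, (Phi x < e%:E)%E.
    have : nbhs (0%:E : \bar R) [set y | (y < e%:E)%E].
      by apply: open_nbhs_nbhs; split; [exact: open_ereal_lt_ereal | rewrite /= lte_fin].
    by have := Phi_rc 0 (lexx 0); rewrite Phi0; apply.
  near ((0:R)^'+) => x; exists x; first by near: x; exact: nbhs_right_gt.
  by apply: ltW; near: x.
exists x => // y y0 yx; rewrite phiE//.
apply: (@le_trans _ _ (\int[lebesgue_measure]_(t in `[0%R, y]) (cst e%:E) t)%E).
  apply: le_integral_nonmeasurable => t /=; rewrite !in_itv/= => /andP[t0 tx].
  - exact: Phi_ge0.
  - by rewrite lee_fin ltW.
  - by rewrite t0 tx; split=> //; apply: le_trans Phix; apply: Phi_nd => //; exact: le_trans yx.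
rewrite integral_cst//= lebesgue_measure_itv/= lte_fin.
case: ifPn => [_|]; first by rewrite oppr0 adde0 -EFinM.
by rewrite mule0 lee_fin mulr_ge0// ltW.
Unshelve. all: by end_near. Qed.

(** As s tends to 0, so does s t - phi(s). *)
Lemma young_conjugate_ge0 (t : R) : 0 <= t -> (0 <= young_conjugate phi t)%E.
Proof.
move=> t0; apply/lee_addgt0Pr => e e0; rewrite -leeBlDr//.
have [x x0 xphi] := young_function_sublinear (@ltr01 R).
pose s := Num.min x e; have s0 : 0 < s by rewrite lt_min x0.
apply: (@le_trans _ _ ((s * t)%:E - phi s)%E); last by apply: ereal_sup_ubound; exists s.
have /xphi : s <= x by rewrite ge_min lexx.
rewrite ltW// mul1r => /(_ isT) /= phis; rewrite add0e.
apply: (@le_trans _ _ (- phi s)%E).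
  rewrite EFinN leeN2; apply: (le_trans phis); rewrite lee_fin ge_min lexx orbT//.
by rewrite leeDr// lee_fin mulr_ge0// ltW.
Qed.

Lemma young_conjugate0 : young_conjugate phi 0 = 0%E.
Proof.
apply/eqP; rewrite eq_le young_conjugate_ge0// andbT.
apply: ge_ereal_sup => _ [s /= s0 <-].
by rewrite mulr0 sub0e oppe_le0 young_function_ge0// ltW.
Qed.

Lemma orlicz_norm_ge0 d (X : measurableType d) (mu : {measure set X -> \bar R})
    (f : X -> R) : (0 <= orlicz_norm mu phi f)%E.
Proof.
apply: ereal_sup_ubound; exists (cst 0) => /=.
  by split=> //; rewrite normr0 young_conjugate0 integral0.
by under eq_integral do rewrite mulr0 normr0; rewrite integral0.
Qed.

Lemma rc_inverse_young_gt0 (u : R) : 0 < u -> 0 < rc_inverse phi u.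
Proof.
move=> u0; have [x x0 xphi] := young_function_sublinear (@ltr01 R).
have m0 : 0 < Num.min x u by rewrite lt_min x0.
apply: (lt_le_trans m0); apply: le_rc_inverse.
- exact: young_function_ndecr.
- exact: young_function_unbounded.
- apply: (@le_trans _ _ (1 * Num.min x u)%:E).
    by apply: xphi; [exact: ltW | rewrite ge_min lexx].
  by rewrite lee_fin mul1r ge_min lexx orbT.
Qed.

Lemma rc_inverse_young0 : rc_inverse phi 0 = 0.
Proof.
apply/eqP; rewrite eq_le rc_inverse_ge0 andbT leNgt; apply/negP => F0.
have s0 : 0 < rc_inverse phi 0 / 2 by rewrite divr_gt0.
have : (phi (rc_inverse phi 0 / 2)%R <= 0%:E)%E.
  by apply: le_of_lt_rc_inverse; [exact: ltW | lra].
by rewrite leNgt young_function_gt0.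
Qed.

(** A sublinear function has a superlinear inverse. *)
Lemma rc_inverse_young_superlinear (M : R) : 0 < M ->
  exists2 u0 : R, 0 < u0 & forall u : R, 0 <= u -> u <= u0 -> M * u <= rc_inverse phi u.
Proof.
move=> M0; have Mi0 : 0 < M^-1 by rewrite invr_gt0.
have [x x0 xphi] := young_function_sublinear Mi0.
exists (x / M); first by rewrite divr_gt0.
move=> u u0; rewrite ler_pdivlMr// mulrC => Mux; apply: le_rc_inverse.
- exact: young_function_ndecr.
- exact: young_function_unbounded.
- by apply: (le_trans (xphi _ _ Mux)); rewrite ?mulr_ge0 ?(ltW M0)// mulKf ?gt_eqF.
Qed.

(** If phi(s) <= u then phi(2 s) <= B u, for every s below the inverse at u. *)
Lemma rc_inverse_young_doubling (B : R) : 0 < B ->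
  (forall s : R, 0 < s -> (phi (2 * s)%R <= B%:E * phi s)%E) ->
  forall u : R, 0 < u -> 2 * rc_inverse phi u <= rc_inverse phi (B * u).
Proof.
move=> B0 phiB u u0; have Fu0 := rc_inverse_young_gt0 u0.
rewrite -ler_pdivlMl//; apply/ler_addgt0Pr => e e0; rewrite -lerBlDr.
have [Fe|eF] := leP (rc_inverse phi u) e.
  apply: (@le_trans _ _ 0); first by rewrite subr_le0.
  by rewrite mulr_ge0 ?rc_inverse_ge0.
rewrite ler_pdivlMl//; apply: le_rc_inverse.
- exact: young_function_ndecr.
- exact: young_function_unbounded.
- apply: (le_trans (phiB _ _)); first by rewrite subr_gt0.
  rewrite EFinM lee_pmul2l//; apply: le_of_lt_rc_inverse; first by rewrite subr_ge0 ltW.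
  by rewrite ltrBlDr ltrDl.
Qed.

Lemma rc_inverse_young_doublingX (B : R) : 0 < B ->
  (forall s : R, 0 < s -> (phi (2 * s)%R <= B%:E * phi s)%E) ->
  forall (n : nat) (u : R), 0 < u -> 2 ^+ n * rc_inverse phi u <= rc_inverse phi (B ^+ n * u).
Proof.
move=> B0 phiB; elim=> [|n IHn] u u0; first by rewrite !expr0 !mul1r.
rewrite !exprS -!mulrA (le_trans _ (rc_inverse_young_doubling B0 phiB _))//.
  by rewrite ler_pM2l// IHn.
by rewrite mulr_gt0// exprn_gt0.
Qed.

End young_function.

(** * Elementary inequalities and dyadic slices *)

Section real_inequalities.
Context {R : realType}.
Implicit Types (p x y u v w c l r : R).

Lemma powR_superadditive p x y : 1 <= p -> 0 <= x -> 0 <= y ->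
  x `^ p + y `^ p <= (x + y) `^ p.
Proof.
move=> p1 x0 y0; have p0 : 0 < p by lra.
have E z : 0 <= z -> z `^ p = z * z `^ (p - 1) by move=> z0; rewrite mulr_powRB1.
rewrite (E x)// (E y)// (E (x + y)) ?addr_ge0// mulrDl lerD// ler_wpM2l//.
- by apply: ge0_ler_powR; rewrite ?nnegrE; lra.
- by apply: ge0_ler_powR; rewrite ?nnegrE; lra.
Qed.

Lemma sum_powR_le p (x : nat -> R) (M : nat) : 1 <= p -> (forall n, 0 <= x n) ->
  \sum_(n < M) x n `^ p <= (\sum_(n < M) x n) `^ p.
Proof.
move=> p1 x0; elim: M => [|M IHM]; first by rewrite !big_ord0 powR_ge0.
rewrite !big_ord_recr/= (le_trans _ (powR_superadditive p1 _ _))//.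
  by rewrite lerD2r.
by rewrite sumr_ge0.
Qed.

(** A substitute for the convexity of the p-th power: it bounds a mean from below
    by a p-th moment with no appeal to Jensen's inequality. *)
Lemma le_powR_affine p c x : 1 <= p -> 0 < c -> 0 <= x ->
  x <= c + c `^ (1 - p) * x `^ p.
Proof.
move=> p1 c0 x0; have [xc|cx] := leP x c.
  by rewrite (le_trans xc)// lerDl mulr_ge0// powR_ge0.
rewrite (@le_trans _ _ (c `^ (1 - p) * x `^ p)) ?lerDr ?(ltW c0)//.
rewrite -(mulr_powRB1 x0); last lra.
have cE : c `^ (1 - p) * c `^ (p - 1) = 1.
  rewrite -powRD ?(gt_eqF c0) ?implybT//.
  by have -> : 1 - p + (p - 1) = 0 by [ring]; rewrite powRr0.
rewrite mulrCA ler_peMr// -[leLHS]cE ler_wpM2l ?powR_ge0//.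
by apply: ge0_ler_powR; rewrite ?nnegrE; lra.
Qed.

(** The part of |v| that lies between the levels l and 2l. *)
Definition slice l v : R := Num.min (Num.max (`|v| - l) 0) l.

Lemma slice_ge0 l v : 0 <= l -> 0 <= slice l v.
Proof. by move=> l0; rewrite /slice le_min l0 le_max lexx orbT. Qed.

Lemma slice_le l v : slice l v <= l.
Proof. by rewrite /slice ge_min lexx orbT. Qed.

Lemma slice_eq0 l v : 0 <= l -> `|v| <= l -> slice l v = 0.
Proof. by move=> l0 vl; rewrite /slice max_r ?subr_le0// min_l. Qed.

Lemma slice_full l v : 0 <= l -> 2 * l <= `|v| -> slice l v = l.
Proof. by move=> l0 vl; rewrite /slice max_l ?min_r//; lra. Qed.

Lemma measurable_slice l : measurable_fun setT (slice l).
Proof.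
apply: measurable_minr => //; apply: measurable_maxr => //.
by apply: measurable_funB => //; exact: measurableT_comp.
Qed.

Lemma slice_mono l v w : `|v| <= `|w| -> slice l v <= slice l w.
Proof.
move=> vw; rewrite /slice /Num.min /Num.max.
by case: (ltP (`|v| - l)) => ?; case: (ltP (`|w| - l)) => ?; repeat case: ltP => ?; lra.
Qed.

(** Consecutive dyadic slices stack up to the truncation of |v| between the lowest
    and the highest level. *)
Lemma sum_slice r v (M : nat) : 0 <= r ->
  \sum_(n < M) slice (r * 2 ^+ n) v = Num.min (Num.max (`|v| - r) 0) (r * 2 ^+ M - r).
Proof.
move=> r0; elim: M => [|M IHM].
  by rewrite big_ord0 expr0 mulr1 subrr min_r// le_max lexx orbT.
have s0 : r <= r * 2 ^+ M by rewrite ler_peMr// exprn_ege1// ler1n.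
rewrite big_ord_recr/= IHM /slice exprS.
set s := r * 2 ^+ M in s0 *; have -> : r * (2 * 2 ^+ M) = 2 * s by rewrite /s; ring.
rewrite /Num.min /Num.max; set z := `|v|; clearbody z s.
case: (ltP (z - r)) => ?; case: (ltP (z - s)) => ?.
- by repeat case: ltP => ?; lra.
- by repeat case: ltP => ?; lra.
- by repeat case: ltP => ?; lra.
- by repeat case: ltP => ?; lra.
Qed.

(** On the real line the distances of the slices add up to the distance of two
    truncations of the absolute value, and the p-th power is superadditive. *)
Lemma sum_slice_dist_le p r v w (M : nat) : 1 <= p -> 0 <= r ->
  \sum_(n < M) `|slice (r * 2 ^+ n) v - slice (r * 2 ^+ n) w| `^ p <= `|v - w| `^ p.
Proof.
move=> p1 r0; wlog vw : v w / `|v| <= `|w|.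
  move=> th; have [/th//|/ltW /th] := leP `|v| `|w|.
  by under eq_bigr do rewrite distrC; rewrite distrC.
pose D (n : nat) := `|slice (r * 2 ^+ n) v - slice (r * 2 ^+ n) w|.
apply: (le_trans (@sum_powR_le p D M p1 _)) => [n|]; first exact: normr_ge0.
rewrite /D {D}.
apply: ge0_ler_powR; rewrite ?nnegrE ?sumr_ge0//; first lra.
under eq_bigr do rewrite distrC ger0_norm ?subr_ge0 ?slice_mono//.
rewrite sumrB !sum_slice// distrC.
apply: (@le_trans _ _ (`|w| - `|v|)); last exact: lerB_dist.
have : r <= r * 2 ^+ M by rewrite ler_peMr// exprn_ege1// ler1n.
move: vw; rewrite /Num.min /Num.max; move: (r * 2 ^+ M) `|v| `|w| => s a b ab rs.
by case: (ltP (a - r)) => ?; case: (ltP (b - r)) => ?; repeat case: ltP => ?; lra.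
Qed.

(** The recursion reads b n <= 2 (b n - b n.+1) + 2 e n, and the first terms
    telescope. *)
Lemma sum_le_of_contracting_recursion (b e : nat -> R) (M : nat) :
  (forall n, 0 <= b n) -> (forall n, b n.+1 <= b n / 2 + e n) ->
  \sum_(n < M) b n <= 2 * b 0%N + 2 * \sum_(n < M) e n.
Proof.
move=> b0 be; suff: \sum_(n < M) b n + 2 * b M <= 2 * b 0%N + 2 * \sum_(n < M) e n.
  by apply: le_trans; rewrite lerDl mulr_ge0.
elim: M => [|M IHM]; first by rewrite !big_ord0 add0r mulr0 addr0.
by rewrite !big_ord_recr/= mulrDr; have := be M; lra.
Qed.

(** Where the measure of the superlevel set drops by the factor K between two
    consecutive levels, doubling makes the next term at most half the current
    one; elsewhere a' is comparable to a and the capacity estimate pays for the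
    next term. *)
Lemma level_recursion (F : R -> R) p K l a a' e :
  F 0 = 0 -> (forall u v : R, u <= v -> F u <= F v) -> (forall u : R, 0 < u -> 0 < F u) ->
  0 < K -> (forall u : R, 0 < u -> 2 * 2 `^ p * F u <= F (K * u)) ->
  0 < p -> 0 < l -> 0 <= a' -> a' <= a -> 0 <= e ->
  (0 < a -> a' * (l / 4) `^ p <= 2 * a * F (2 * a)^-1 * e) ->
  (2 * l) `^ p / F (2 * a')^-1
    <= l `^ p / F (2 * a)^-1 / 2 + 2 * K * 8 `^ p * e.
Proof.
move=> F0 Fnd Fgt0 K0 FK p0 l0 a'0 a'a e0 key.
have Fge0 u : 0 <= u -> 0 <= F u by move=> u0; rewrite -F0 Fnd.
have a0 : 0 <= a by exact: le_trans a'a.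
have T0 : 0 <= l `^ p / F (2 * a)^-1.
  by rewrite divr_ge0 ?powR_ge0// Fge0// invr_ge0 mulr_ge0.
have c0 : 0 <= 2 * K * 8 `^ p * e by rewrite !mulr_ge0 ?powR_ge0// ltW.
have [->|a'n0] := eqVneq a' 0.
  by rewrite mulr0 invr0 F0 invr0 mulr0 addr_ge0// divr_ge0.
have {a'n0}a'0 : 0 < a' by rewrite lt_neqAle eq_sym a'n0.
have {}a0 : 0 < a by exact: lt_le_trans a'a.
have {}key := key a0.
have Fa : 0 < F (2 * a)^-1 by rewrite Fgt0// invr_gt0 mulr_gt0.
have Fa' : 0 < F (2 * a')^-1 by rewrite Fgt0// invr_gt0 mulr_gt0.
have lp : 0 < l `^ p by rewrite powR_gt0.
have p2 : 0 < (2:R) `^ p by rewrite powR_gt0.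
rewrite powRM ?(ltW l0)//.
have [Ka|aK] := leP (K * a') a.
  apply: (@le_trans _ _ (l `^ p / F (2 * a)^-1 / 2)); last by rewrite lerDl.
  have : 2 * 2 `^ p * F (2 * a)^-1 <= F (2 * a')^-1.
    apply: (le_trans (FK _ _)); first by rewrite invr_gt0 mulr_gt0.
    apply: Fnd; rewrite ler_pdivrMr ?mulr_gt0// mulrC ler_pdivlMr ?mulr_gt0//; lra.
  move=> FF; rewrite ler_pdivrMr//.
  have -> : l `^ p / F (2 * a)^-1 / 2 * F (2 * a')^-1
      = l `^ p * F (2 * a')^-1 / (2 * F (2 * a)^-1) by field; rewrite gt_eqF.
  by rewrite ler_pdivlMr ?mulr_gt0//; have := ler_wpM2l (ltW lp) FF; lra.
apply: (@le_trans _ _ (2 `^ p * (l `^ p / F (2 * a)^-1))).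
  rewrite mulrA ler_wpM2l ?mulr_ge0 ?powR_ge0// lef_pV2 ?posrE//.
  by apply: Fnd; rewrite lef_pV2 ?posrE ?mulr_gt0// ler_pM2l.
suff : l `^ p / F (2 * a)^-1 <= 2 * K * 4 `^ p * e.
  move=> th; apply: (@le_trans _ _ (2 * K * 8 `^ p * e)); last by rewrite lerDr divr_ge0.
  have -> : (8:R) = 2 * 4 by ring.
  by rewrite powRM//; have := ler_wpM2l (ltW p2) th; lra.
rewrite ler_pdivrMr//.
have q4 : 0 < (4:R) `^ p by rewrite powR_gt0.
have E : (l / 4) `^ p * 4 `^ p = l `^ p.
  by rewrite -powRM ?divr_ge0 ?(ltW l0)// divfK.
rewrite -(ler_pM2l a'0) -E.
have -> : a' * ((l / 4) `^ p * 4 `^ p) = (a' * (l / 4) `^ p) * 4 `^ p by ring.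
apply: (le_trans (ler_wpM2r (ltW q4) key)).
have -> : 2 * a * F (2 * a)^-1 * e * 4 `^ p = a * (2 * F (2 * a)^-1 * e * 4 `^ p) by ring.
have -> : a' * (2 * K * 4 `^ p * e * F (2 * a)^-1) = (K * a') * (2 * F (2 * a)^-1 * e * 4 `^ p).
  by ring.
by rewrite ler_wpM2r ?(ltW aK)// !mulr_ge0// ltW.
Qed.

End real_inequalities.

(** * Orlicz norm of a set and deviation from the mean *)

(** By Young's inequality s |g| <= phi(s) + psi(|g|), with s chosen so that
    phi(s) mu(A) <= 1/2; this is the bound on the Orlicz norm of an indicator
    function. *)
Lemma orlicz_set_bound (R : realType) d (X : measurableType d)
    (mu : {measure set X -> \bar R}) (phi : R -> \bar R) (A : set X) (a : R) (g : X -> R) :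
  young_function phi -> measurable A -> mu A = a%:E -> measurable_fun setT g ->
  (\int[mu]_x young_conjugate phi `|g x|%R <= 1)%E ->
  (\int[mu]_(x in A) `|g x|%:E <= (3 / rc_inverse phi (2 * a)^-1)%:E)%E.
Proof.
move=> phi_young mA muA mg g1; set F := rc_inverse phi _.
have a_ge0 : 0 <= a by rewrite -lee_fin -muA.
have mng : measurable_fun setT (fun x => `|g x|%R) by exact: measurableT_comp.
have mngA : measurable_fun A (fun x => `|g x|%R) by exact: measurable_funTS.
have [a0|an0] := eqVneq a 0.
  rewrite null_set_integral//; first by rewrite lee_fin divr_ge0// rc_inverse_ge0.
  - exact/measurable_EFinP.
  - by rewrite muA a0.
have {an0}a0 : 0 < a by rewrite lt_neqAle eq_sym an0.
have F0 : 0 < F by apply: rc_inverse_young_gt0 => //; rewrite invr_gt0 mulr_gt0.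
pose c := (2 * a)^-1; have c0 : 0 < c by rewrite invr_gt0 mulr_gt0.
pose s := F / 2; have s0 : 0 < s by rewrite divr_gt0.
have phis : (phi s <= c%:E)%E.
  by apply: le_of_lt_rc_inverse; rewrite ?ltW// -/F /s; lra.
(* As phi(s) <= c, Young's inequality gives v <= psi(|g|). *)
pose v x := Num.max (s * `|g x| - c) 0.
have mv : measurable_fun A v.
  apply: measurable_maxr => //; apply: measurable_funB => //.
  exact: measurable_funM.
have v_le x : ((v x)%:E <= young_conjugate phi `|g x|)%E.
  rewrite /v maxEge; case: ifPn => _; last exact: young_conjugate_ge0.
  apply: (@le_trans _ _ ((s * `|g x|)%:E - phi s)%E); last first.
    by apply: ereal_sup_ubound; exists s.
  by rewrite EFinB; apply: leeB.
have : (s%:E * \int[mu]_(x in A) `|g x|%:E <= (c * a)%:E + 1)%E.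
  rewrite -ge0_integralZl_EFin//; last 2 first.
    exact/measurable_EFinP.
    exact: ltW.
  apply: (@le_trans _ _ (\int[mu]_(x in A) (c%:E + (v x)%:E))%E).
    apply: le_integral_nonmeasurable => x Ax.
    - by rewrite mule_ge0// lee_fin// ltW.
    - by rewrite adde_ge0// lee_fin ?(ltW c0)// /v le_max lexx orbT.
    - split=> //; rewrite -EFinM -EFinD lee_fin /v maxEge.
      by case: ifPn => /=; rewrite ?subr_ge0 -?ltNge; lra.
  rewrite ge0_integralD//; last 3 first.
    by move=> x _; rewrite lee_fin ltW.
    by move=> x _; rewrite lee_fin /v le_max lexx orbT.
    exact/measurable_EFinP.
  rewrite integral_cst// [X in (_ * X + _)%E](_ : _ = a%:E)// -EFinM leeD2l//.
  apply: (le_trans _ g1); apply: le_integral_nonmeasurable => x Ax.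
  - by rewrite lee_fin /v le_max lexx orbT.
  - exact: young_conjugate_ge0.
  - by split.
have -> : (c * a)%:E = (2^-1)%:E :> \bar R.
  by congr EFin; rewrite /c invfM -mulrA mulVf ?gt_eqF// mulr1.
rewrite -EFinD muleC -lee_pdivlMr//.
move/le_trans; apply; rewrite -EFinM lee_fin /s invf_div mulrA.
by rewrite ler_wpM2r ?invr_ge0 ?(ltW F0)//; lra.
Qed.

Section mean_deviation.
Context d (X : measurableType d) (R : realType).

(** The mean of l - w is at least l / 2. Compared with the affine bound at c = l / 4,
    this leaves at least l / 4 to the term that carries the p-th moment. *)
Lemma probability_deviation (m : {measure set X -> \bar R}) (w : X -> R) (p l : R) :
  m setT = 1%E -> 1 <= p -> 0 < l -> measurable_fun setT w -> (forall x, 0 <= w x <= l) ->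
  (\int[m]_x (w x)%:E <= (l / 2)%:E)%E ->
  (((l / 4) `^ p)%:E <= \int[m]_x (`|w x - l| `^ p)%:E)%E.
Proof.
move=> m1 p1 l0 mw wl wint; pose c := l / 4; have c0 : 0 < c by rewrite divr_gt0.
have w0 x : 0 <= w x by case/andP: (wl x).
have lw0 x : 0 <= l - w x by rewrite subr_ge0; case/andP: (wl x).
have mlw : measurable_fun setT (fun x => l - w x) by exact: measurable_funB.
have mwp : measurable_fun setT (fun x => `|w x - l| `^ p).
  apply: (measurableT_comp (measurable_powR p)); apply: measurableT_comp => //.
  exact: measurable_funB.
have l_le : (l%:E <= \int[m]_x (l - w x)%:E + (l / 2)%:E)%E.
  apply: (@le_trans _ _ (\int[m]_x (l - w x)%:E + \int[m]_x (w x)%:E)%E); last exact: leeD2l.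
  rewrite -ge0_integralD//; last 4 first.
  - by move=> x _; rewrite lee_fin.
  - exact/measurable_EFinP.
  - by move=> x _; rewrite lee_fin.
  - exact/measurable_EFinP.
  under eq_integral do rewrite -EFinD subrK.
  by rewrite integral_cst // [X in (_ * X)%E]m1 mule1.
have : (\int[m]_x (l - w x)%:E <= c%:E + (c `^ (1 - p))%:E * \int[m]_x (`|w x - l| `^ p)%:E)%E.
  rewrite -ge0_integralZl_EFin ?powR_ge0//; last exact/measurable_EFinP.
  have {1}-> : (c%:E = \int[m]_x (cst c%:E) x)%E.
    by rewrite integral_cst // [X in (_ * X)%E]m1 mule1.
  rewrite -ge0_integralD//; last 3 first.
  - by move=> x _; rewrite lee_fin ltW.
  - by move=> x _; rewrite mule_ge0 ?lee_fin ?powR_ge0.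
  - by apply: measurable_funeM; exact/measurable_EFinP.
  apply: le_integral_nonmeasurable => x _ /=.
  - by rewrite lee_fin.
  - by rewrite adde_ge0 ?mule_ge0 ?lee_fin ?powR_ge0// ltW.
  - split=> //; rewrite -EFinM -EFinD lee_fin distrC ger0_norm//.
    exact: le_powR_affine.
move: l_le; case: (\int[m]_x (`|w x - l| `^ p)%:E)%E => [I| |]; last 2 first.
- by rewrite leey.
- by rewrite gt0_muleNy ?lte_fin ?powR_gt0//= addeNy leeNy_eq => h /eqP h'; rewrite h' in h.
rewrite -EFinM -EFinD; case: (\int[m]_x (l - w x)%:E)%E => [J| |]; rewrite ?leeyr//.
  rewrite -EFinD !lee_fin => lJ JI.
  have cI : c <= c `^ (1 - p) * I by rewrite /c in JI *; lra.
  have := ler_wpM2l (powR_ge0 c (p - 1)) cI.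
  have cE : c `^ (p - 1) * c `^ (1 - p) = 1.
    rewrite -powRD ?(gt_eqF c0) ?implybT//.
    by have -> : p - 1 + (1 - p) = 0 by [ring]; rewrite powRr0.
  rewrite [leRHS]mulrA cE mul1r mulrC mulr_powRB1// ?(ltW c0)//; lra.
Qed.

End mean_deviation.

(** * Energies and Besov norms *)

Section energy.
Context d (X : measurableType d) (R : realType).
Variable mu : {measure set X -> \bar R}.

Definition energy (kt : R.-pker X ~> X) (p : R) (f : X -> R) : \bar R :=
  (\int[mu]_y kernel_op kt (fun x => `|f x - f y| `^ p)%R y)%E.

Lemma measurable_dist_powR (p : R) (f : X -> R) (y : R) : measurable_fun setT f ->
  measurable_fun setT (fun x => `|f x - y| `^ p).
Proof.
move=> mf; apply: (measurableT_comp (measurable_powR p)).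
by apply: measurableT_comp => //; apply: measurable_funB.
Qed.

Lemma energy_density_ge0 (kt : R.-pker X ~> X) (p : R) (f : X -> R) (y : X) :
  (0 <= kernel_op kt (fun x => `|f x - f y| `^ p)%R y)%E.
Proof. by apply: integral_ge0 => x _; rewrite lee_fin powR_ge0. Qed.

Lemma energy_ge0 (kt : R.-pker X ~> X) (p : R) (f : X -> R) : (0 <= energy kt p f)%E.
Proof. by apply: integral_ge0 => y _; exact: energy_density_ge0. Qed.

Lemma measurable_energy_density (kt : R.-pker X ~> X) (p : R) (f : X -> R) :
  measurable_fun setT f ->
  measurable_fun setT (fun y => kernel_op kt (fun x => `|f x - f y| `^ p)%R y).
Proof.
move=> mf.
apply: (measurable_fun_integral_finite_kernel
  (fun z : X * X => (`|f z.2 - f z.1| `^ p)%:E) kt) => [z|].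
  by rewrite lee_fin powR_ge0.
apply/measurable_EFinP; apply: (measurableT_comp (measurable_powR p)).
apply: measurableT_comp => //; apply: measurable_funB; exact: measurableT_comp.
Qed.

Lemma sum_energy_slice_le (kt : R.-pker X ~> X) (p r : R) (f : X -> R) (M : nat) :
  1 <= p -> 0 <= r -> measurable_fun setT f ->
  (\sum_(n < M) energy kt p (slice (r * 2 ^+ n) \o f) <= energy kt p f)%E.
Proof.
move=> p1 r0 mf.
have ms n : measurable_fun setT (slice (r * 2 ^+ n) \o f).
  exact: measurableT_comp (measurable_slice _) mf.
rewrite /energy -ge0_integral_sum//; last 2 first.
- by move=> n; exact: measurable_energy_density.
- by move=> n y _; exact: energy_density_ge0.
apply: le_integral_nonmeasurable => y _.
- by apply: sume_ge0 => n _; exact: energy_density_ge0.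
- exact: energy_density_ge0.
split=> //; rewrite /kernel_op -ge0_integral_sum//; last first.
  by move=> n; apply/measurable_EFinP; exact: measurable_dist_powR.
apply: le_integral_nonmeasurable => x _.
- by apply: sume_ge0 => n _; rewrite lee_fin powR_ge0.
- by rewrite lee_fin powR_ge0.
by split=> //; rewrite sumEFin lee_fin; exact: sum_slice_dist_le.
Qed.

Lemma energy_slice_le (kt : R.-pker X ~> X) (p l : R) (f : X -> R) :
  1 <= p -> 0 <= l -> measurable_fun setT f ->
  (energy kt p (slice l \o f) <= energy kt p f)%E.
Proof.
move=> p1 l0 mf; have := sum_energy_slice_le kt 1 p1 l0 mf.
by rewrite big_ord1 expr0 mulr1.
Qed.

(** Seen from a point of S, where w takes its maximal value l, the mean of w under
    the heat kernel is at most l / 2, so the deviation bound applies there. *)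
Lemma energy_ge_of_small_mean (kt : R.-pker X ~> X) (p l : R) (w : X -> R) (S : set X) :
  1 <= p -> 0 < l -> measurable_fun setT w -> (forall x, 0 <= w x <= l) ->
  measurable S -> (forall y, S y -> w y = l) ->
  (\forall y \ae mu, (kernel_op kt w y <= (l / 2)%:E)%E) ->
  (((l / 4) `^ p)%:E * mu S <= energy kt p w)%E.
Proof.
move=> p1 l0 mw wl mS wS small.
rewrite -integral_cst//.
apply: (@le_trans _ _ (\int[mu]_(y in S) kernel_op kt (fun x => `|w x - w y| `^ p)%R y)%E).
  apply: ae_ge0_le_integral => //.
  - by move=> y _; rewrite lee_fin powR_ge0.
  - by move=> y _; exact: energy_density_ge0.
  - apply: measurable_funTS; exact: measurable_energy_density.
  apply: filterS small => y wy Sy; rewrite (wS _ Sy).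
  exact: (probability_deviation (prob_kernel y)).
apply: le_integral_nonmeasurable => y _; try by exact: energy_density_ge0.
by split.
Qed.

Variables (k : R -> R.-pker X ~> X) (p : R) (h : R -> R).
Hypothesis p1 : 1 <= p.

Let p0 : 0 < p. Proof. exact: lt_le_trans ltr01 p1. Qed.

Let energyK (t : R) (f : X -> R) : ((energy (k t) p f `^ p^-1) `^ p = energy (k t) p f)%E.
Proof.
by rewrite -poweRrM mulVf ?gt_eqF// poweRe1// energy_ge0.
Qed.

Let quotientE t (f : X -> R) : 0 < h t ->
  besov_quotient mu k p h f t = (((h t)^-1)%:E * energy (k t) p f `^ p^-1)%E.
Proof. by move=> ht; rewrite /besov_quotient inver gt_eqF. Qed.

Lemma energy_le_of_quotient (t N : R) (f : X -> R) : 0 < h t -> 0 <= N ->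
  (besov_quotient mu k p h f t <= N%:E)%E -> (energy (k t) p f <= ((h t * N) `^ p)%:E)%E.
Proof.
move=> ht N0; rewrite quotientE// lee_pdivrMl// -EFinM => EN.
rewrite -energyK -poweR_EFin; apply: gt0_ler_poweR => //; first exact: ltW.
- by rewrite in_itv/= poweR_ge0 leey.
- by rewrite in_itv/= lee_fin mulr_ge0 ?(ltW ht)// leey.
Qed.

Lemma energy_ge_of_quotient (t N : R) (f : X -> R) : 0 < h t -> 0 <= N ->
  (N%:E <= besov_quotient mu k p h f t)%E -> (((h t * N) `^ p)%:E <= energy (k t) p f)%E.
Proof.
move=> ht N0; rewrite quotientE// lee_pdivlMl// -EFinM => EN.
rewrite -energyK -poweR_EFin; apply: gt0_ler_poweR => //; first exact: ltW.
- by rewrite in_itv/= lee_fin mulr_ge0 ?(ltW ht)// leey.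
- by rewrite in_itv/= poweR_ge0 leey.
Qed.

Lemma besov_quotient_ge0 (t : R) (f : X -> R) : 0 < h t ->
  (0 <= besov_quotient mu k p h f t)%E.
Proof.
by move=> ht; rewrite quotientE// mule_ge0 ?poweR_ge0// lee_fin invr_ge0 ltW.
Qed.

Hypothesis h_gt0 : forall t : R, 0 < t -> 0 < h t.

Lemma besov_norm_ge0 (f : X -> R) : (0 <= besov_norm mu k p h f)%E.
Proof.
apply: (le_trans (besov_quotient_ge0 f (h_gt0 (@ltr01 R)))).
by apply: ereal_sup_ubound; exists 1 => //=.
Qed.

Lemma besov_norm_slice_le (l : R) (f : X -> R) : 0 <= l -> measurable_fun setT f ->
  (besov_norm mu k p h (slice l \o f) <= besov_norm mu k p h f)%E.
Proof.
move=> l0 mf; apply: ge_ereal_sup => _ [t /= t0 <-].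
apply: (@le_trans _ _ (besov_quotient mu k p h f t)); last first.
  by apply: ereal_sup_ubound; exists t.
have ht := h_gt0 t0; rewrite (quotientE _ ht) (quotientE f ht).
apply: lee_wpmul2l; first by rewrite lee_fin invr_ge0 ltW.
apply: gt0_ler_poweR.
- by rewrite invr_ge0 ltW.
- by rewrite in_itv/= leey andbT energy_ge0.
- by rewrite in_itv/= leey andbT energy_ge0.
- exact: energy_slice_le.
Qed.

End energy.

(** * Almost everywhere bounds *)

Section Lebesgue_classes.
Context d (X : measurableType d) (R : realType).
Variable mu : {measure set X -> \bar R}.

Lemma Lfun_measurable (q : \bar R) (f : X -> R) : f \in Lfun mu q -> measurable_fun setT f.
Proof. by move=> /sub_Lfun_mfun; rewrite inE. Qed.

Lemma LfunP_integral (q : R) (f : X -> R) : 0 < q ->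
  f \in Lfun mu q%:E <->
  measurable_fun setT f /\ (\int[mu]_x (`|f x| `^ q)%:E < +oo)%E.
Proof.
move=> q0.
have E : ('N[mu]_(q%:E)[EFin \o f] = (\int[mu]_x (`|f x| `^ q)%:E) `^ q^-1)%E.
  by rewrite unlock.
split=> [fq|[mf fq]].
  split; first exact: Lfun_measurable fq.
  have := sub_Lfun_finLfun fq; rewrite inE /finite_norm/= E => /lty_poweRy; apply.
  by rewrite invr_neq0// gt_eqF.
rewrite inE; apply/andP; split; first by rewrite inE.
by rewrite inE/= /finite_norm E; exact: poweR_lty.
Qed.

Lemma ae_le_of_Lnormy (f : X -> \bar R) (M : \bar R) :
  ('N[mu]_+oo[f] <= M)%E -> \forall x \ae mu, (`|f x| <= M)%E.
Proof.
rewrite unlock /Lnorm; case: ifPn => [_ /ess_supP//|].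
rewrite -leNgt measure_le0 => /eqP muT _; exists setT; split=> //.
Qed.

(** If v_n tends to g in L^2 while |v_n| <= M, then |g| <= M: the excess
    (|g| - M)^+ is dominated by |v_n - g|. *)
Lemma ae_le_of_L2_approx (g : X -> R) (v : R -> X -> R) (M : R) :
  measurable_fun setT g -> (forall e : R, 0 < e -> measurable_fun setT (v e)) ->
  (forall e : R, 0 < e -> \forall x \ae mu, `|v e x| <= M) ->
  L2dist mu (v e) g @[e --> 0^'+] --> 0%E ->
  \forall x \ae mu, `|g x| <= M.
Proof.
move=> mg mv vM vg.
pose D x : R := Num.max (`|g x| - M) 0.
have D0 x : 0 <= D x by rewrite /D le_max lexx orbT.
have mD : measurable_fun setT D.
  by apply: measurable_maxr => //; apply: measurable_funB => //; exact: measurableT_comp.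
have Dle (e : R) : 0 < e -> ('N[mu]_(2%:E)[EFin \o D] <= L2dist mu (v e) g)%E.
  move=> e0; rewrite /L2dist unlock /Lnorm.
  apply: gt0_ler_poweR; rewrite ?in_itv/= ?leey ?andbT ?invr_ge0//.
  - by apply: integral_ge0 => x _ /=; rewrite ?lee_fin powR_ge0.
  - by apply: integral_ge0 => x _ /=; rewrite ?lee_fin powR_ge0.
  apply: ae_ge0_le_integral => //.
  - apply/measurable_EFinP.
    by apply: (measurableT_comp (measurable_powR 2)); exact: measurableT_comp.
  - apply/measurable_EFinP.
    apply: (measurableT_comp (measurable_powR 2)); apply: measurableT_comp => //.
    by apply: measurable_funB => //; exact: mv.
  apply: filterS (vM e e0) => x vx _ /=.
  rewrite lee_fin; apply: ge0_ler_powR; rewrite ?nnegrE//.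
  rewrite ger0_norm// /D ge_max normr_ge0 andbT distrC.
  by have := lerB_dist (g x) (v e x); lra.
have : ('N[mu]_(2%:E)[EFin \o D] <= 0)%E.
  apply: (cvge_to_ge vg).
  near=> e; apply: Dle; near: e; exact: nbhs_right_gt.
move=> N0; have {}N0 : ('N[mu]_(2%:E)[EFin \o D] = 0)%E.
  by apply/eqP; rewrite eq_le N0 Lnorm_ge0.
have mD' : measurable_fun setT (EFin \o D) by exact/measurable_EFinP.
have D_ae : (EFin \o D = cst 0%E %[ae mu])%E.
  by apply: Lnorm_eq0_eq0 N0; rewrite ?lte_fin.
apply: filterS D_ae => x /(_ I) /= [] Dx.
by rewrite -subr_le0 -Dx /D le_max lexx.
Unshelve. all: by end_near. Qed.

End Lebesgue_classes.

(** * Heat flow and superlevel sets *)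

Section level_set_estimate.
Context d (X : measurableType d) (R : realType).
Variable mu : {measure set X -> \bar R}.
Variables (P : R -> (X -> R) -> (X -> R)) (k : R -> R.-pker X ~> X).
Hypothesis P_markov : markov_semigroup mu P.
Hypothesis P_kernel : represented_by mu P k.

(** Strong continuity in L^2 carries a bound on P_s w for s > t down to s = t. *)
Lemma ae_semigroup_le_right (t M : R) (w : X -> R) : 0 <= t -> w \in Lfun mu 2%:E ->
  (forall s : R, t < s -> \forall x \ae mu, (`|kernel_op (k s) w x| <= M%:E)%E) ->
  \forall x \ae mu, `|P t w x| <= M.
Proof.
move=> t0 w2 wM; have Pw2 := sg_L2 P_markov t0 w2.
apply: (ae_le_of_L2_approx _ _ _ (sg_cont P_markov Pw2)).
- exact: Lfun_measurable Pw2.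
- by move=> e e0; exact: Lfun_measurable (sg_L2 P_markov (ltW e0) Pw2).
move=> e e0; have et : t < e + t by rewrite ltrDr.
have et0 : 0 <= e + t by rewrite addr_ge0// ltW.
apply: filterS3 (wM _ et) (P_kernel et0 w2) (sg_D P_markov (ltW e0) t0 w2) => x.
by move=> + + /(_ I) => /[swap] <- /[swap] ->.
Qed.

Variable V : R -> R.
Hypothesis V_ndecr : forall s t : R, 0 <= s -> s <= t -> V s <= V t.
Hypothesis V_oo : V t @[t --> +oo] --> +oo.
Hypothesis ultracontractive : forall (f : X -> R) (t : R), f \in Lfun mu 1%:E -> 0 < t ->
  ('N[mu]_+oo[kernel_op (k t) f] <= (V t)%:E^-1 * 'N[mu]_1[EFin \o f])%E.

(** Ultracontractivity gives this bound at every time s > t = V^-1(2a), where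
    V(s) > 2a, but V may jump at t itself; continuity of the semigroup from the
    right recovers time t, the one at which h is controlled. *)
Lemma ae_heat_le_half (a l : R) (w : X -> R) : 0 < a -> 0 <= l ->
  w \in Lfun mu 1%:E -> w \in Lfun mu 2%:E -> ('N[mu]_1[EFin \o w] <= (l * a)%:E)%E ->
  \forall x \ae mu, `|P (rc_inverse (EFin \o V) (2 * a)) w x| <= l / 2.
Proof.
move=> a0 l0 w1 w2 wla; apply: ae_semigroup_le_right => //; first exact: rc_inverse_ge0.
move=> s ts; have s0 : 0 < s by apply: le_lt_trans ts; exact: rc_inverse_ge0.
have Vs : 2 * a < V s.
  rewrite -lte_fin; apply: (@lt_of_rc_inverse_lt _ (EFin \o V)) ts.
    by move=> x y x0 xy; rewrite lee_fin V_ndecr.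
  move=> u; have [b [_ bV]] := (cvgryPgt _).1 V_oo u.
  exists (Num.max 0 (b + 1)); first by rewrite le_max lexx.
  by rewrite /= lte_fin bV// lt_max ltrDl ltr01 orbT.
have Vs0 : 0 < V s by apply: lt_trans Vs; rewrite mulr_gt0.
apply: ae_le_of_Lnormy; apply: (le_trans (ultracontractive w1 s0)).
rewrite inver gt_eqF// lee_pdivrMl// (le_trans wla)// -EFinM lee_fin.
by have := ler_wpM2l l0 (ltW Vs); lra.
Qed.

Variables (p : R) (h : R -> R).
Hypothesis p1 : 1 <= p.
Hypothesis h_gt0 : forall t : R, 0 < t -> 0 < h t.

(** At time t = V^-1(2a) the heat flow has brought w below l/2. A point of S is
    thus at distance at least l/2 from the mean of w under the heat kernel, and
    every such point contributes to the energy of w at time t. *)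
Lemma level_set_estimate (a l N : R) (w : X -> R) (S : set X) :
  0 < a -> 0 < l -> (forall x, 0 <= w x <= l) ->
  w \in Lfun mu 1%:E -> w \in Lfun mu 2%:E -> ('N[mu]_1[EFin \o w] <= (l * a)%:E)%E ->
  0 <= N -> (besov_norm mu k p h w <= N%:E)%E ->
  measurable S -> (forall x, S x -> w x = l) ->
  (((l / 4) `^ p)%:E * mu S <= ((h (rc_inverse (EFin \o V) (2 * a)) * N) `^ p)%:E)%E.
Proof.
move=> a0 l0 wl w1 w2 wla N0 wN mS wS; set t := rc_inverse _ _.
have t0 : 0 <= t by exact: rc_inverse_ge0.
have Pw : \forall x \ae mu, `|P t w x| <= l / 2 by apply: ae_heat_le_half => //; exact: ltW.
(* P_0 is the identity: w <= l / 2 almost everywhere, hence S is null. *)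
have [t_eq0|tn0] := eqVneq t 0.
  have : mu S = 0.
    apply: (measure_negligible mS).
    have : \forall x \ae mu, ~ S x.
      rewrite t_eq0 in Pw; apply: filterS2 Pw (sg_0 P_markov w2) => x Px /(_ I) PE Sx.
      by move: Px; rewrite PE (wS _ Sx) gtr0_norm//; lra.
    by case=> B [mB B0 SB]; exists B; split=> // x Sx; apply: SB => /(_ Sx).
  by move=> ->; rewrite mule0 lee_fin powR_ge0.
have {}t0 : 0 < t by rewrite lt_neqAle eq_sym tn0.
apply: (@le_trans _ _ (energy mu (k t) p w)).
  apply: energy_ge_of_small_mean => //; first exact: Lfun_measurable w1.
  apply: filterS2 Pw (P_kernel (ltW t0) w2) => x Px <-.
  by rewrite lee_fin (le_trans (ler_norm _)).
apply: energy_le_of_quotient => //; first exact: h_gt0.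
by apply: le_trans wN; apply: ereal_sup_ubound; exists t.
Qed.

End level_set_estimate.

(** * Besov norms of the slices *)

Section slices_of_a_function.
Context d (X : measurableType d) (R : realType).
Variable mu : {measure set X -> \bar R}.
Implicit Types (f : X -> R) (l r p q : R).

Definition superlevel f l : set X := [set x | l < `|f x|].

Lemma measurable_superlevel f l : measurable_fun setT f ->
  measurable (superlevel f l).
Proof.
move=> mf; rewrite -[X in measurable X]setTI /superlevel.
rewrite [X in _ `&` X](_ : _ = (fun x => `|f x|) @^-1` `]l, +oo[%classic); last first.
  by apply/seteqP; split=> x /=; rewrite in_itv/= andbT.
have mnf : measurable_fun setT (fun x => `|f x|) by exact: measurableT_comp.
by apply: mnf => //; exact: measurable_itv.
Qed.

Lemma superlevel_chebyshev p f l : 0 <= p -> 0 <= l -> measurable_fun setT f ->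
  ((l `^ p)%:E * mu (superlevel f l) <= \int[mu]_x (`|f x| `^ p)%:E)%E.
Proof.
move=> p0 l0 mf; rewrite -integral_cst; last exact: measurable_superlevel.
apply: le_integral_nonmeasurable => x /=; rewrite ?lee_fin ?powR_ge0// => lf.
by split=> //; apply: ge0_ler_powR; rewrite ?nnegrE// ltW.
Qed.

Lemma superlevel_fin_num p f l : 0 < p -> 0 < l -> f \in Lfun mu p%:E ->
  mu (superlevel f l) \is a fin_num.
Proof.
move=> p0 l0 /(LfunP_integral _ _ p0)[mf fp]; rewrite ge0_fin_numE//.
have := le_lt_trans (superlevel_chebyshev (ltW p0) (ltW l0) mf) fp.
case: (mu _) => //; first by move=> r _; exact: ltry.
by rewrite gt0_muley// lte_fin powR_gt0.
Qed.

Lemma integral_slice_powR_le q f l : 0 < q -> 0 < l -> measurable_fun setT f ->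
  (\int[mu]_x (`|(slice l \o f) x| `^ q)%:E <= (l `^ q)%:E * mu (superlevel f l))%E.
Proof.
move=> q0 l0 mf; rewrite -integral_cst; last exact: measurable_superlevel.
rewrite [leRHS]integral_mkcond; apply: le_integral_nonmeasurable => x _.
- by rewrite lee_fin powR_ge0.
- by apply: erestrict_ge0 => y _; rewrite lee_fin powR_ge0.
split=> //; rewrite /patch; case: ifPn => lf.
  rewrite lee_fin; apply: ge0_ler_powR; rewrite ?nnegrE ?(ltW q0) ?(ltW l0)//.
  by rewrite /= ger0_norm ?slice_le// slice_ge0// ltW.
have fl : `|f x| <= l by rewrite leNgt; apply: contra lf => lf; exact: mem_set.
by rewrite /= slice_eq0 ?(ltW l0)// normr0 powR0 ?gt_eqF.
Qed.

Lemma slice_Lfun p q f l : 0 < p -> 0 < q -> 0 < l -> f \in Lfun mu p%:E ->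
  slice l \o f \in Lfun mu q%:E.
Proof.
move=> p0 q0 l0 fp; have mf := Lfun_measurable fp.
apply/(LfunP_integral _ _ q0); split; first exact: measurableT_comp (measurable_slice _) mf.
apply: le_lt_trans (integral_slice_powR_le q0 l0 mf) _.
by rewrite -(fineK (superlevel_fin_num p0 l0 fp)) -EFinM ltry.
Qed.

Lemma slice_Lnorm1_le p f l : 0 < p -> 0 < l -> f \in Lfun mu p%:E ->
  ('N[mu]_1[EFin \o (slice l \o f)] <= (l * fine (mu (superlevel f l)))%:E)%E.
Proof.
move=> p0 l0 fp; have mf := Lfun_measurable fp.
rewrite EFinM fineK ?(superlevel_fin_num p0)// Lnorm1.
have := integral_slice_powR_le ltr01 l0 mf.
rewrite (powRr1 (ltW l0)); apply: le_trans.
by apply: le_integral_nonmeasurable => x _; rewrite ?abse_ge0 ?lee_fin ?powR_ge0// powRr1.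
Qed.

Variables (k : R -> R.-pker X ~> X) (p : R) (h : R -> R).
Hypothesis p1 : 1 <= p.
Hypothesis h_gt0 : forall t : R, 0 < t -> 0 < h t.

Let p0 : 0 < p. Proof. exact: lt_le_trans ltr01 p1. Qed.

Lemma besov_class_slice f l : 0 < l -> besov_class mu k p h f ->
  besov_class mu k p h (slice l \o f).
Proof.
move=> l0 [fp fN]; split; first exact: slice_Lfun fp.
apply: le_lt_trans fN; apply: besov_norm_slice_le => //; first exact: ltW.
exact: Lfun_measurable fp.
Qed.

Lemma besov_norm_fineK f : besov_class mu k p h f ->
  (fine (besov_norm mu k p h f))%:E = besov_norm mu k p h f.
Proof. by move=> [_ fN]; rewrite fineK// ge0_fin_numE// besov_norm_ge0. Qed.

Variable C0 : R.
Hypothesis C0_gt0 : 0 < C0.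
Hypothesis besov_norm_liminf : forall f, besov_class mu k p h f ->
  (besov_norm mu k p h f <= C0%:E * limf_einf (besov_quotient mu k p h f) (0^'+))%E.

(** The factor 2 gives room to turn the bound by the lower limit into a bound at
    every small time. *)
Lemma besov_norm_le_quotient_near f : besov_class mu k p h f ->
  \forall t \near 0^'+,
    ((fine (besov_norm mu k p h f) / (2 * C0))%:E <= besov_quotient mu k p h f t)%E.
Proof.
move=> fB; have NE := besov_norm_fineK fB.
set N := fine _ in NE *; have N0 : 0 <= N by apply: fine_ge0; exact: besov_norm_ge0.
have C20 : 0 < 2 * C0 by rewrite mulr_gt0.
have [->|Nn0] := eqVneq N 0.
  near=> t; rewrite mul0r; apply: besov_quotient_ge0 => //; apply: h_gt0.
  by near: t; exact: nbhs_right_gt.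
have {Nn0}N0 : 0 < N by rewrite lt_neqAle eq_sym Nn0.
have : ((N / (2 * C0))%:E < limf_einf (besov_quotient mu k p h f) (0^'+))%E.
  apply: (@lt_le_trans _ _ (C0^-1%:E * N%:E)%E).
    rewrite -EFinM lte_fin mulrC ltr_pM2r// invfM gtr_pMl ?invr_gt0//.
    by rewrite invf_lt1// ltr1n.
  by rewrite lee_pdivrMl// NE; exact: besov_norm_liminf.
rewrite limf_einfE => /ereal_sup_gt[_ [W W0 <-]] NW.
apply: filterS W0 => t Wt; apply: (le_trans (ltW NW)).
by apply: ereal_inf_lbound; exists t.
Unshelve. all: by end_near. Qed.

(** At one small time the energy of each slice controls its Besov norm up to a
    constant factor, and together these energies do not exceed the energy of f. *)
Lemma sum_besov_norm_slice_le f r (M : nat) : 0 < r -> besov_class mu k p h f ->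
  \sum_(n < M) fine (besov_norm mu k p h (slice (r * 2 ^+ n) \o f)) `^ p
    <= (2 * C0) `^ p * fine (besov_norm mu k p h f) `^ p.
Proof.
move=> r0 fB; have mf := Lfun_measurable fB.1.
pose N n := fine (besov_norm mu k p h (slice (r * 2 ^+ n) \o f)).
rewrite -[leLHS]/(\sum_(n < M) N n `^ p).
have N0 n : 0 <= N n by apply: fine_ge0; exact: besov_norm_ge0.
have l0 n : 0 < r * 2 ^+ n by rewrite mulr_gt0// exprn_gt0.
have C20 : 0 < 2 * C0 by rewrite mulr_gt0.
have near_all : \forall t \near (0 : R)^'+, forall n : 'I_M,
    ((N n / (2 * C0))%:E <= besov_quotient mu k p h (slice (r * 2 ^+ n) \o f) t)%E.
  apply: filter_forall => n; apply: besov_norm_le_quotient_near.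
  exact: besov_class_slice.
have [t [t0 tN]] : exists t : R, 0 < t /\ forall n : 'I_M,
    ((N n / (2 * C0))%:E <= besov_quotient mu k p h (slice (r * 2 ^+ n) \o f) t)%E.
  near ((0 : R)^'+) => t; exists t; split; first by near: t; exact: nbhs_right_gt.
  by near: t.
have ht := h_gt0 t0.
have Nf0 : 0 <= fine (besov_norm mu k p h f) by apply: fine_ge0; exact: besov_norm_ge0.
have : (\sum_(n < M) ((h t * (N n / (2 * C0))) `^ p)%:E
    <= ((h t * fine (besov_norm mu k p h f)) `^ p)%:E)%E.
  apply: (@le_trans _ _ (\sum_(n < M) energy mu (k t) p (slice (r * 2 ^+ n) \o f))%E).
    apply: lee_sum => n _; apply: energy_ge_of_quotient (tN n) => //.
    exact: divr_ge0 (N0 n) (ltW C20).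
  apply: (le_trans (sum_energy_slice_le _ _ M p1 (ltW r0) mf)).
  apply: energy_le_of_quotient => //.
  by rewrite besov_norm_fineK//; apply: ereal_sup_ubound; exists t.
rewrite sumEFin lee_fin powRM ?(ltW ht)//.
have q0 n : 0 <= N n / (2 * C0) := divr_ge0 (N0 n) (ltW C20).
rewrite (eq_bigr (fun n : 'I_M => h t `^ p * (N n / (2 * C0)) `^ p)); last first.
  by move=> n _; exact: powRM (ltW ht) (q0 n).
rewrite -mulr_sumr ler_pM2l ?powR_gt0//.
move=> NN; apply: (le_trans _ (ler_wpM2l (powR_ge0 (2 * C0) p) NN)).
rewrite mulr_sumr; apply: ler_sum => n _.
rewrite -(powRM _ (ltW C20) (q0 n)).
have NK : 2 * C0 * (N n / (2 * C0)) = N n.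
  by rewrite mulrC; apply: divfK; rewrite gt_eqF.
rewrite NK.
exact: lexx.
Unshelve. all: by end_near. Qed.

End slices_of_a_function.

(** * Level sums and the Orlicz norm *)

Lemma exists_pow2_gt (R : realType) (x : R) : exists n : nat, x < 2 ^+ n.
Proof.
exists (Num.bound `|x|); apply: (le_lt_trans (ler_norm x)).
apply: (lt_le_trans (archi_boundP (normr_ge0 x))).
by rewrite -natrX ler_nat ltnW// ltn_expl.
Qed.

Section orlicz_level_sum.
Context d (X : measurableType d) (R : realType).
Variable mu : {measure set X -> \bar R}.
Variable phi : R -> \bar R.
Hypothesis phi_young : young_function phi.
Variable p : R.
Hypothesis p1 : 1 <= p.
Implicit Types (f g : X -> R) (l r : R).

Let p0 : 0 < p. Proof. exact: lt_le_trans ltr01 p1. Qed.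

(** Up to constants, the contribution of the level l to the Orlicz norm of |f|^p. *)
Definition level_term f l : R :=
  l `^ p / rc_inverse phi (2 * fine (mu (superlevel f l)))^-1.

Lemma level_term_ge0 f l : 0 <= level_term f l.
Proof. by rewrite divr_ge0 ?powR_ge0// rc_inverse_ge0. Qed.

Definition band f l l' : set X := superlevel f l `\` superlevel f l'.

Lemma measurable_band f l l' : measurable_fun setT f -> measurable (band f l l').
Proof. by move=> mf; apply: measurableD; exact: measurable_superlevel. Qed.

Lemma integral_band_le f g l : f \in Lfun mu p%:E -> measurable_fun setT g ->
  (\int[mu]_x young_conjugate phi `|g x|%R <= 1)%E -> 0 < l ->
  (\int[mu]_(x in band f l (2 * l)) (`|f x| `^ p * `|g x|)%:E
    <= (3 * 2 `^ p * level_term f l)%:E)%E.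
Proof.
move=> fp mg g1 l0; have mf := Lfun_measurable fp.
have mS := measurable_superlevel l mf.
have c0 : 0 <= (2 * l) `^ p by exact: powR_ge0.
apply: (@le_trans _ _ (((2 * l) `^ p)%:E * \int[mu]_(x in superlevel f l) `|g x|%:E)%E).
  rewrite -ge0_integralZl_EFin//; last first.
    by apply/measurable_EFinP; apply: measurable_funTS; exact: measurableT_comp.
  apply: le_integral_nonmeasurable => x.
  - by rewrite lee_fin mulr_ge0// powR_ge0.
  - by rewrite mule_ge0// lee_fin.
  move=> [lf /negP lf']; split=> //; rewrite -EFinM lee_fin ler_wpM2r//.
  apply: ge0_ler_powR; rewrite ?nnegrE ?(ltW p0)//; first by rewrite mulr_ge0// ltW.
  by rewrite leNgt.
have aE : mu (superlevel f l) = (fine (mu (superlevel f l)))%:E.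
  by rewrite fineK// (superlevel_fin_num p0).
have gS := orlicz_set_bound phi_young mS aE mg g1.
apply: (le_trans (lee_wpmul2l _ gS)); first by rewrite lee_fin.
rewrite -EFinM lee_fin powRM ?(ltW l0)// /level_term.
by rewrite le_eqVlt; apply/orP; left; apply/eqP; ring.
Qed.

Lemma integral_bands_le f g r (M : nat) : f \in Lfun mu p%:E -> measurable_fun setT g ->
  (\int[mu]_x young_conjugate phi `|g x|%R <= 1)%E -> 0 < r ->
  (\int[mu]_(x in band f r (r * 2 ^+ M)) (`|f x| `^ p * `|g x|)%:E
    <= (3 * 2 `^ p * \sum_(n < M) level_term f (r * 2 ^+ n))%:E)%E.
Proof.
move=> fp mg g1 r0; have mf := Lfun_measurable fp.
have mfg : measurable_fun setT (fun x => (`|f x| `^ p * `|g x|)%:E).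
  apply/measurable_EFinP; apply: measurable_funM; last exact: measurableT_comp.
  by apply: (measurableT_comp (measurable_powR p)); exact: measurableT_comp.
elim: M => [|M IHM].
  by rewrite big_ord0 mulr0 expr0 mulr1 /band setDv integral_set0.
have rr : r <= r * 2 ^+ M by rewrite ler_peMr ?(ltW r0)// exprn_ege1// ler1n.
have rr' : r * 2 ^+ M <= r * 2 ^+ M.+1 by rewrite ler_pM2l// ler_eXn2l// ltr1n.
have -> : band f r (r * 2 ^+ M.+1) =
    band f r (r * 2 ^+ M) `|` band f (r * 2 ^+ M) (2 * (r * 2 ^+ M)).
  rewrite mulrCA -exprS; apply/seteqP; split=> x /=.
    rewrite /band /superlevel /= => -[rf nf].
    by have [fM|Mf] := leP `|f x| (r * 2 ^+ M); [left | right]; split.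
  case=> -[/= rf /negP nf]; split=> //=; rewrite /superlevel/=.
  - by apply/negP; rewrite -leNgt (le_trans _ rr')// leNgt.
  - exact: le_lt_trans rr rf.
  - exact/negP.
rewrite (ge0_integral_setU _ (measurable_band _ _ mf) (measurable_band _ _ mf)); last 3 first.
- exact: measurable_funTS.
- by move=> x _; rewrite lee_fin mulr_ge0 ?powR_ge0.
- rewrite disj_set2E; apply/eqP/seteqP; split=> // x [[_ nf] [Mf _]]; exact: nf.
rewrite big_ord_recr/= mulrDr EFinD; apply: leeD => //.
by apply: integral_band_le => //; rewrite mulr_gt0// exprn_gt0.
Qed.

(** Chebyshev's inequality bounds the measure of the superlevel set by a multiple of
    r^-p, and the inverse of phi is superlinear at the origin. *)
Lemma level_term_vanish f (e : R) : f \in Lfun mu p%:E -> 0 < e ->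
  exists2 r0 : R, 0 < r0 & forall r, 0 < r -> r <= r0 -> level_term f r <= e.
Proof.
move=> fp e0; have /(LfunP_integral _ _ p0)[mf If] := fp.
pose A := fine (\int[mu]_x (`|f x| `^ p)%:E)%E + 1.
have I0 : (0 <= \int[mu]_x (`|f x| `^ p)%:E)%E.
  by apply: integral_ge0 => x _; rewrite lee_fin powR_ge0.
have A0 : 0 < A by rewrite ltr_wpDl// fine_ge0.
have IA : (\int[mu]_x (`|f x| `^ p)%:E <= A%:E)%E.
  have If' : (\int[mu]_x (`|f x| `^ p)%:E)%E \is a fin_num by rewrite ge0_fin_numE.
  by rewrite -(fineK If') lee_fin lerDl.
have M0 : 0 < 2 * A / e by rewrite divr_gt0// mulr_gt0.
have [u0 u0_gt0 FM] := rc_inverse_young_superlinear phi_young M0.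
have Au0 : 0 < 2 * A * u0 by rewrite !mulr_gt0.
exists ((2 * A * u0) `^ p^-1); first by rewrite powR_gt0.
move=> r r0 rr0; rewrite /level_term; set a := fine _.
have a0 : 0 <= a by exact: fine_ge0.
have rp : 0 < r `^ p by rewrite powR_gt0.
have aA : r `^ p * a <= A.
  rewrite -lee_fin EFinM fineK ?(superlevel_fin_num p0)//.
  exact: le_trans (superlevel_chebyshev _ (ltW p0) (ltW r0) mf) IA.
have [->|an0] := eqVneq a 0.
  by rewrite mulr0 invr0 rc_inverse_young0// invr0 mulr0 ltW.
have {an0}a0 : 0 < a by rewrite lt_neqAle eq_sym an0.
pose u := r `^ p / (2 * A); have u_gt0 : 0 < u by rewrite divr_gt0// mulr_gt0.
have uu0 : u <= u0.
  rewrite ler_pdivrMr ?mulr_gt0// mulrC.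
  have -> : 2 * A * u0 = ((2 * A * u0) `^ p^-1) `^ p.
    by rewrite -powRrM mulVf ?gt_eqF// powRr1// ltW.
  by apply: ge0_ler_powR; rewrite ?nnegrE ?powR_ge0 ?(ltW p0) ?(ltW r0).
have ua : u <= (2 * a)^-1.
  rewrite /u ler_pdivrMr ?mulr_gt0// mulrC ler_pdivlMr ?mulr_gt0//.
  by have := aA; lra.
have Fu : 2 * A / e * u <= rc_inverse phi (2 * a)^-1.
  apply: (le_trans (FM _ (ltW u_gt0) uu0)); apply: rc_inverse_ndecr => //.
  exact: young_function_unbounded.
have Mu : 2 * A / e * u = r `^ p / e by rewrite /u; field; rewrite !gt_eqF.
have F0 : 0 < rc_inverse phi (2 * a)^-1.
  by apply: lt_le_trans Fu; rewrite Mu divr_gt0.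
rewrite ler_pdivrMr//; move: Fu; rewrite Mu ler_pdivrMr// mulrC.
by [].
Qed.

Lemma bigcup_band f : \bigcup_n band f ((2 ^+ n)^-1) (2 ^+ n) = [set x | 0 < `|f x|].
Proof.
apply/seteqP; split=> x /=.
  by move=> [n _ [/= nf _]]; apply: lt_trans nf; rewrite invr_gt0 exprn_gt0.
move=> f0; have [n] := exists_pow2_gt (`|f x| + `|f x|^-1).
have fi0 : 0 < `|f x|^-1 by rewrite invr_gt0.
move=> nf; exists n => //; split; rewrite /superlevel/=.
  by rewrite invf_plt ?posrE ?exprn_gt0//; apply: le_lt_trans nf; rewrite lerDr ltW.
by apply/negP; rewrite -leNgt ltW//; apply: le_lt_trans nf; rewrite lerDl ltW.
Qed.

(** Letting the lowest level tend to 0 and the highest to +oo, the first term of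
    the level sum disappears. *)
Lemma orlicz_norm_le_of_level_sums f (K : R) : f \in Lfun mu p%:E ->
  (forall r (M : nat), 0 < r ->
    \sum_(n < M) level_term f (r * 2 ^+ n) <= 2 * level_term f r + K) ->
  (orlicz_norm mu phi (fun x => `|f x| `^ p)%R <= (3 * 2 `^ p * K)%:E)%E.
Proof.
move=> fp sumK; have mf := Lfun_measurable fp.
apply: ge_ereal_sup => _ [g /= [mg g1] <-].
have mfg : measurable_fun setT (fun x => (`|f x| `^ p * `|g x|)%:E).
  apply/measurable_EFinP; apply: measurable_funM; last exact: measurableT_comp.
  by apply: (measurableT_comp (measurable_powR p)); exact: measurableT_comp.
have fg0 x : (0 <= (`|f x| `^ p * `|g x|)%:E)%E by rewrite lee_fin mulr_ge0 ?powR_ge0.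
apply: (@le_trans _ _
    (\int[mu]_(x in \bigcup_n band f ((2 ^+ n)^-1) (2 ^+ n)) (`|f x| `^ p * `|g x|)%:E)%E).
  rewrite bigcup_band (integral_mkcond [set x | _]).
  apply: le_integral_nonmeasurable => x _; first by rewrite lee_fin.
    by apply: erestrict_ge0 => y _; exact: fg0.
  split=> //; rewrite /patch normrM [`|_ `^ p|]ger0_norm ?powR_ge0//.
  case: ifPn => // /negP f0.
  have -> : `|f x| = 0.
    by apply/eqP; rewrite eq_le normr_ge0 andbT leNgt; apply/negP => fx; apply: f0; exact: mem_set.
  by rewrite powR0 ?gt_eqF// mul0r.
apply/lee_addgt0Pr => e e0.
have q2 : 0 < 3 * (2:R) `^ p by rewrite mulr_gt0// powR_gt0.
have e20 : 0 < e / (3 * 2 `^ p * 2) by rewrite divr_gt0// mulr_gt0.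
have [r0 r0_gt0 small] := level_term_vanish fp e20.
have cvg_int := @ge0_nondecreasing_set_cvg_integral _ _ _
  (fun n => band f ((2 ^+ n)^-1) (2 ^+ n)) (fun x => (`|f x| `^ p * `|g x|)%:E) mu.
apply: (cvge_to_le (cvg_int _ _ _ _)).
- apply/nondecreasing_seqP => n; apply/subsetPset => x [/= nf /negP nf'].
  split; rewrite /superlevel/=.
    apply: le_lt_trans nf; rewrite lef_pV2 ?posrE ?exprn_gt0//.
    by rewrite ler_eXn2l// ltr1n.
  apply/negP; rewrite -leNgt; apply: (@le_trans _ _ (2 ^+ n)); first by rewrite leNgt.
  by rewrite ler_eXn2l// ltr1n.
- by move=> n; exact: measurable_band.
- by move=> n; exact: measurable_funTS.
- by move=> n x _; exact: fg0.
have [N rN] := exists_pow2_gt r0^-1.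
exists N => // n /= Nn.
have n0 : 0 < (2 ^+ n : R)^-1 by rewrite invr_gt0 exprn_gt0.
have nr0 : (2 ^+ n)^-1 <= r0.
  rewrite invf_ple ?posrE ?exprn_gt0//; apply: (le_trans (ltW rN)).
  by rewrite ler_eXn2l// ltr1n.
(* From the level 2^-n up to the level 2^n there are n + n doublings. *)
have := integral_bands_le (n + n) fp mg g1 n0.
rewrite exprD mulrA mulVf ?gt_eqF ?exprn_gt0// mul1r => /le_trans; apply.
rewrite -EFinD lee_fin; apply: (le_trans (ler_wpM2l (ltW q2) (sumK _ _ n0))).
rewrite mulrDr addrC lerD2l.
have := ler_wpM2l (ltW q2) (small _ n0 nr0).
have -> : 3 * 2 `^ p * (e / (3 * 2 `^ p * 2)) = e / 2.
  by field; rewrite gt_eqF// powR_gt0.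
by lra.
Qed.

End orlicz_level_sum.

(** * Summation over the levels *)

Section level_sum_estimate.
Context d (X : measurableType d) (R : realType).
Variable mu : {measure set X -> \bar R}.
Variables (P : R -> (X -> R) -> (X -> R)) (k : R -> R.-pker X ~> X).
Variables (p : R) (h V : R -> R) (phi : R -> \bar R) (C0 B : R).
Hypothesis P_markov : markov_semigroup mu P.
Hypothesis P_kernel : represented_by mu P k.
Hypothesis p1 : 1 <= p.
Hypothesis h_ge0 : forall t : R, 0 <= t -> 0 <= h t.
Hypothesis h_gt0 : forall t : R, 0 < t -> 0 < h t.
Hypothesis C0_gt0 : 0 < C0.
Hypothesis besov_norm_liminf : forall f, besov_class mu k p h f ->
  (besov_norm mu k p h f <= C0%:E * limf_einf (besov_quotient mu k p h f) (0^'+))%E.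
Hypothesis V_ndecr : forall s t : R, 0 <= s -> s <= t -> V s <= V t.
Hypothesis V_oo : V t @[t --> +oo] --> +oo.
Hypothesis ultracontractive : forall (f : X -> R) (t : R), f \in Lfun mu 1%:E -> 0 < t ->
  ('N[mu]_+oo[kernel_op (k t) f] <= (V t)%:E^-1 * 'N[mu]_1[EFin \o f])%E.
Hypothesis phi_young : young_function phi.
Hypothesis B_gt0 : 0 < B.
Hypothesis phi_doubling : forall s : R, 0 < s -> (phi (2 * s)%R <= B%:E * phi s)%E.
Hypothesis h_le : forall s : R, 0 < s ->
  (h (rc_inverse (EFin \o V) s)) `^ p <= s * rc_inverse phi s^-1.

Let p0 : 0 < p. Proof. exact: lt_le_trans ltr01 p1. Qed.

(** The slice of f at height l vanishes below the level l and equals l above 2l, so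
    that the level set estimate relates the two superlevel sets; the growth
    condition on h turns the time into the measure of the lower one. *)
Lemma superlevel_capacity (f : X -> R) (l : R) : besov_class mu k p h f -> 0 < l ->
  0 < fine (mu (superlevel f l)) ->
  fine (mu (superlevel f (2 * l))) * (l / 4) `^ p
    <= 2 * fine (mu (superlevel f l)) * rc_inverse phi (2 * fine (mu (superlevel f l)))^-1
       * fine (besov_norm mu k p h (slice l \o f)) `^ p.
Proof.
move=> fB l0 a0; have fp := fB.1; have mf := Lfun_measurable fp.
have l20 : 0 < 2 * l by rewrite mulr_gt0.
have sB := besov_class_slice p1 h_gt0 l0 fB.
have N0 : 0 <= fine (besov_norm mu k p h (slice l \o f)).
  by apply: fine_ge0; exact: besov_norm_ge0.
have NE := besov_norm_fineK h_gt0 sB.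
have wl x : 0 <= (slice l \o f) x <= l by rewrite /= slice_ge0 ?slice_le// ltW.
have NN : (besov_norm mu k p h (slice l \o f)
    <= (fine (besov_norm mu k p h (slice l \o f)))%:E)%E by rewrite NE.
have wS x : superlevel f (2 * l) x -> (slice l \o f) x = l.
  by move=> lf; rewrite /= slice_full// ltW.
have w1 := slice_Lfun p0 ltr01 l0 fp.
have w2 := slice_Lfun p0 (ltr0n R 2) l0 fp.
have := level_set_estimate P_markov P_kernel V_ndecr V_oo ultracontractive p1 h_gt0
  a0 l0 wl w1 w2 (slice_Lnorm1_le p0 l0 fp) N0 NN (measurable_superlevel (2 * l) mf) wS.
rewrite -(fineK (superlevel_fin_num p0 l20 fp)) -EFinM lee_fin mulrC => /le_trans; apply.
have t0 := rc_inverse_ge0 (EFin \o V) (2 * fine (mu (superlevel f l))).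
rewrite (powRM _ (h_ge0 t0) N0).
by apply: ler_wpM2r; [exact: powR_ge0 | apply: h_le; rewrite mulr_gt0].
Qed.

(** Doubling m times multiplies the inverse of phi by 2^m >= 2 * 2^p, at the cost of
    the factor B^m in its argument. *)
Lemma level_term_recursion (m : nat) (f : X -> R) (l : R) : 2 * 2 `^ p <= 2 ^+ m :> R ->
  besov_class mu k p h f -> 0 < l ->
  level_term mu phi p f (2 * l) <= level_term mu phi p f l / 2
    + 2 * B ^+ m * 8 `^ p * fine (besov_norm mu k p h (slice l \o f)) `^ p.
Proof.
move=> pm fB l0; have mf := Lfun_measurable fB.1.
apply: (level_recursion (rc_inverse_young0 phi_young)).
- by move=> u v uv; apply: rc_inverse_ndecr => //; exact: young_function_unbounded.
- by move=> u; exact: rc_inverse_young_gt0.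
- exact: exprn_gt0.
- move=> u u0; apply: le_trans (rc_inverse_young_doublingX phi_young B_gt0 phi_doubling m u0).
  by apply: ler_wpM2r => //; exact: rc_inverse_ge0.
- exact: p0.
- exact: l0.
- exact: fine_ge0.
- have l20 : 0 < 2 * l by rewrite mulr_gt0.
  apply: (fine_le (superlevel_fin_num p0 l20 fB.1) (superlevel_fin_num p0 l0 fB.1)).
  apply: le_measure; rewrite ?inE; [exact: measurable_superlevel..|].
  by move=> x; rewrite /superlevel/= => /(le_lt_trans _); apply; lra.
- exact: powR_ge0.
- exact: superlevel_capacity.
Qed.

Lemma sum_level_term_le (m : nat) (f : X -> R) (r : R) (M : nat) :
  2 * 2 `^ p <= 2 ^+ m :> R -> besov_class mu k p h f -> 0 < r ->
  \sum_(n < M) level_term mu phi p f (r * 2 ^+ n) <= 2 * level_term mu phi p f r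
    + 4 * B ^+ m * 8 `^ p * (2 * C0) `^ p * fine (besov_norm mu k p h f) `^ p.
Proof.
move=> pm fB r0; pose c : R := 2 * B ^+ m * 8 `^ p.
have c0 : 0 <= c by rewrite !mulr_ge0 ?powR_ge0// exprn_ge0// ltW.
pose b n := level_term mu phi p f (r * 2 ^+ n).
pose e n := c * fine (besov_norm mu k p h (slice (r * 2 ^+ n) \o f)) `^ p.
have b0 n : 0 <= b n by exact: level_term_ge0.
have be n : b n.+1 <= b n / 2 + e n.
  rewrite /b exprS mulrCA; apply: level_term_recursion => //.
  by rewrite mulr_gt0// exprn_gt0.
apply: (le_trans (sum_le_of_contracting_recursion M b0 be)).
rewrite /b expr0 mulr1 lerD2l /e -mulr_sumr.
have := sum_besov_norm_slice_le p1 h_gt0 C0_gt0 besov_norm_liminf M r0 fB.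
move=> /(ler_wpM2l c0) /(ler_wpM2l (ler0n R 2)) /le_trans; apply.
by rewrite le_eqVlt; apply/orP; left; apply/eqP; rewrite /c; ring.
Qed.

End level_sum_estimate.

(** * The Orlicz-Sobolev inequality *)

Theorem theorem2p14 (R : realType) (d : measure_display) (X : measurableType d)
    (mu : {sigma_finite_measure set X -> \bar R})
    (D : set (X -> R)) (E : (X -> R) -> (X -> R) -> R)
    (P : R -> (X -> R) -> (X -> R)) (k : R -> R.-pker X ~> X)
    (p : R) (h V : R -> R) (phi : R -> \bar R)
    (X_cg : countably_generated X) (X_md : measure_decomposition R X)
    (ED_dirichlet : dirichlet_form mu D E)
    (P_heat : heat_semigroup mu D E P) (P_cons : conservative mu P)
    (P_kernel : represented_by mu P k)
    (p_ge1 : 1 <= p)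
    (h_incr : forall s t : R, 0 <= s -> s < t -> h s < h t)
    (h_0 : h 0 = 0) (h_oo : h t @[t --> +oo] --> +oo)
    (H1 : exists C0 : R, 0 < C0 /\ forall f : X -> R, besov_class mu k p h f ->
      (besov_norm mu k p h f
         <= C0%:E * limf_einf (besov_quotient mu k p h f) (0^'+))%E)
    (V_ge0 : forall t : R, 0 <= t -> 0 <= V t)
    (V_ndecr : forall s t : R, 0 <= s -> s <= t -> V s <= V t)
    (V_oo : V t @[t --> +oo] --> +oo)
    (H2 : forall (f : X -> R) (t : R), f \in Lfun mu 1%:E -> 0 < t ->
      ('N[mu]_+oo[kernel_op (k t) f] <= (V t)%:E^-1 * 'N[mu]_1[EFin \o f])%E)
    (phi_young : young_function phi)
    (phi_doubling : exists B : R, 0 < B /\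
      forall s : R, 0 < s -> (phi (2 * s)%R <= B%:E * phi s)%E)
    (H3 : forall s : R, 0 < s ->
      (h (rc_inverse (EFin \o V) s)) `^ p <= s * rc_inverse phi s^-1) :
  exists C : R, 0 < C /\ forall f : X -> R, besov_class mu k p h f ->
    ((orlicz_norm mu phi (fun x => (`|f x| `^ p)%R)) `^ p^-1
       <= C%:E * besov_norm mu k p h f)%E.
Proof.
have [C0 [C0_gt0 besov_liminf]] := H1.
have [B [B_gt0 phi_B]] := phi_doubling.
have p0 : 0 < p := lt_le_trans ltr01 p_ge1.
have h_gt0 (t : R) : 0 < t -> 0 < h t by move=> t0; rewrite -h_0 h_incr.
have h_ge0 (t : R) : 0 <= t -> 0 <= h t.
  by rewrite le_eqVlt => /predU1P[<-|/h_gt0/ltW//]; rewrite h_0.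
have [m pm] := exists_pow2_gt (2 * 2 `^ p : R).
(* 3 * 2^p comes from one band between two levels, and the other factor from the
   summation of the recursion over all levels. *)
pose K : R := 3 * 2 `^ p * (4 * B ^+ m * 8 `^ p * (2 * C0) `^ p).
have K0 : 0 < K by rewrite !mulr_gt0 ?powR_gt0 ?exprn_gt0 ?mulr_gt0.
exists (K `^ p^-1); split; first exact: powR_gt0.
move=> f fB; set N := fine (besov_norm mu k p h f).
have N0 : 0 <= N by apply: fine_ge0; exact: besov_norm_ge0.
have NE : N%:E = besov_norm mu k p h f := besov_norm_fineK h_gt0 fB.
have norm_le : (orlicz_norm mu phi (fun x => `|f x| `^ p)%R <= (K * N `^ p)%:E)%E.
  have -> : K * N `^ p = 3 * 2 `^ p * (4 * B ^+ m * 8 `^ p * (2 * C0) `^ p * N `^ p).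
    by rewrite /K !mulrA.
  apply: (orlicz_norm_le_of_level_sums phi_young p_ge1 fB.1) => r M r0.
  exact: (sum_level_term_le (proj1 P_heat) P_kernel p_ge1 h_ge0 h_gt0 C0_gt0 besov_liminf
    V_ndecr V_oo H2 phi_young B_gt0 phi_B H3 M (ltW pm) fB r0).
have orlicz0 : (0 <= orlicz_norm mu phi (fun x => `|f x| `^ p)%R)%E.
  exact: orlicz_norm_ge0.
have -> : ((K `^ p^-1)%:E * besov_norm mu k p h f = ((K * N `^ p)%:E `^ p^-1))%E.
  rewrite -NE poweR_EFin -EFinM powRM ?powR_ge0 ?(ltW K0)//.
  by rewrite -powRrM mulfV ?gt_eqF// powRr1.
apply: gt0_ler_poweR norm_le.
- by rewrite invr_ge0 ltW.
- by rewrite in_itv/= orlicz0 leey.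
- by rewrite in_itv/= leey andbT lee_fin mulr_ge0 ?powR_ge0// ltW.
Qed.
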